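(* Let $(V;\rho^l,\rho^m,\rho^r)$ be a representation of a 3-Leibniz algebra $(\mathfrak g,[\cdot,\cdot,\cdot]_{\mathfrak g})$ and let $\Phi$ be a 2-cocycle of $\mathfrak g$ with coefficients in $V$. Then the graded vector space $\mathfrak C^\ast(V,\mathfrak g)=\bigoplus_{n\ge 0}\mathfrak C^{n+1}(V,\mathfrak g)$ is an $L_\infty$-algebra with $l_1=l_2=0$, with the maps $l_3(\cdot,\cdot,\cdot)$ and $l_4(\cdot,\cdot,\cdot,\cdot)$ defined in the context, and with $l_n=0$ for $n\ge 5$. Moreover, a linear map $T:V\to\mathfrak g$ is a $\Phi$-twisted Rota-Baxter operator if and only if $T$ is a solution of the Maurer-Cartan equation of this $L_\infty$-algebra, i.e. $$\frac{1}{3!}l_3(T,T,T)+\frac{1}{4!}l_4(T,T,T,T)=0 .$$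
   Context: All vector spaces are over an algebraically closed field $\mathbb K$ of characteristic $0$. A 3-Leibniz algebra is a vector space $\mathfrak g$ with a trilinear map $[\cdot,\cdot,\cdot]_{\mathfrak g}$ satisfying $[a,b,[x,y,z]_{\mathfrak g}]_{\mathfrak g}=[[a,b,x]_{\mathfrak g},y,z]_{\mathfrak g}+[x,[a,b,y]_{\mathfrak g},z]_{\mathfrak g}+[x,y,[a,b,z]_{\mathfrak g}]_{\mathfrak g}$. A representation of $\mathfrak g$ is a vector space $V$ with trilinear maps $\rho^l:\mathfrak g\otimes\mathfrak g\otimes V\to V$, $\rho^m:\mathfrak g\otimes V\otimes\mathfrak g\to V$, $\rho^r:V\otimes\mathfrak g\otimes\mathfrak g\to V$ such that for all $a,b,x,y,z\in\mathfrak g$, $u\in V$: $\rho^l(a,b,\rho^l(x,y,u))=\rho^l([a,b,x]_{\mathfrak g},y,u)+\rho^l(x,[a,b,y]_{\mathfrak g},u)+\rho^l(x,y,\rho^l(a,b,u))$; $\rho^l(a,b,\rho^m(x,u,z))=\rho^m([a,b,x]_{\mathfrak g},u,z)+\rho^m(x,\rho^l(a,b,u),z)+\rho^m(x,u,[a,b,z]_{\mathfrak g})$; $\rho^l(a,b,\rho^r(u,y,z))=\rho^r(\rho^l(a,b,u),y,z)+\rho^r(u,[a,b,y]_{\mathfrak g},z)+\rho^r(u,y,[a,b,z]_{\mathfrak g})$; $\rho^m(a,u,[x,y,z]_{\mathfrak g})=\rho^r(\rho^m(a,u,x),y,z)+\rho^m(x,\rho^m(a,u,y),z)+\rho^l(x,y,\rho^m(a,u,z))$;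 $\rho^r(u,b,[x,y,z]_{\mathfrak g})=\rho^r(\rho^r(u,b,x),y,z)+\rho^m(x,\rho^r(u,b,y),z)+\rho^l(x,y,\rho^r(u,b,z))$. A 2-cocycle is a trilinear map $\Phi:\mathfrak g\otimes\mathfrak g\otimes\mathfrak g\to V$ with $\Phi(a,b,[x,y,z]_{\mathfrak g})+\rho^l(a,b,\Phi(x,y,z))=\Phi([a,b,x]_{\mathfrak g},y,z)+\Phi(x,[a,b,y]_{\mathfrak g},z)+\Phi(x,y,[a,b,z]_{\mathfrak g})+\rho^l(x,y,\Phi(a,b,z))+\rho^m(x,\Phi(a,b,y),z)+\rho^r(\Phi(a,b,x),y,z)$. A linear map $T:V\to\mathfrak g$ is a $\Phi$-twisted Rota-Baxter operator if $[Tu,Tv,Tw]_{\mathfrak g}=T\big(\rho^l(Tu,Tv,w)+\rho^m(Tu,v,Tw)+\rho^r(u,Tv,Tw)+\Phi(Tu,Tv,Tw)\big)$ for all $u,v,w\in V$. Graded Lie algebra: for a vector space $W$ and $n\ge0$ let $\mathfrak C^{n+1}(W,W)=\mathrm{Hom}((\otimes^2W)^{\otimes n}\otimes W,W)$, placed in degree $n$. For $P\in\mathfrak C^{p+1}(W,W)$, $Q\in\mathfrak C^{q+1}(W,W)$ put $[P,Q]_{\mathrm{3Leib}}=P\circ Q-(-1)^{pq}Q\circ P$ where, for $\mathfrak X_i=x_i\otimes y_i\in\otimes^2W$, $x\in W$, $$\begin{aligned}(P\circ Q)(\mathfrak X_1,\dots,\mathfrak X_{p+q},x)=&\sum_{k=1}^p(-1)^{(k-1)q}\sum_{\sigma\in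 S(k-1,q)}(-1)^\sigma P(\mathfrak X_{\sigma(1)},\dots,\mathfrak X_{\sigma(k-1)},Q(\mathfrak X_{\sigma(k)},\dots,\mathfrak X_{\sigma(k+q-1)},x_{k+q})\otimes y_{k+q},\mathfrak X_{k+q+1},\dots,\mathfrak X_{p+q},x)\\&+\sum_{k=1}^p(-1)^{(k-1)q}\sum_{\sigma\in S(k-1,q)}(-1)^\sigma P(\mathfrak X_{\sigma(1)},\dots,\mathfrak X_{\sigma(k-1)},x_{k+q}\otimes Q(\mathfrak X_{\sigma(k)},\dots,\mathfrak X_{\sigma(k+q-1)},y_{k+q}),\mathfrak X_{k+q+1},\dots,\mathfrak X_{p+q},x)\\&+\sum_{\sigma\in S(p,q)}(-1)^{pq}(-1)^\sigma P(\mathfrak X_{\sigma(1)},\dots,\mathfrak X_{\sigma(p)},Q(\mathfrak X_{\sigma(p+1)},\dots,\mathfrak X_{\sigma(p+q)},x)).\end{aligned}$$ Here $S(i,j)$ is the set of permutations $\sigma$ of $\{1,\dots,i+j\}$ with $\sigma(1)<\dots<\sigma(i)$ and $\sigma(i+1)<\dots<\sigma(i+j)$, and $(-1)^\sigma$ is the sign. This is a graded Lie algebra. Take $W=\mathfrak g\oplus V$. Let $\Omega=\mu+\rho^l+\rho^m+\rho^r+\Phi\in\mathfrak C^2(W,W)$ be given by $\Omega(x+u,y+v,z+w)=[x,y,z]_{\mathfrak g}+\rho^l(x,y,w)+\rho^m(x,v,z)+\rho^r(u,y,z)+\Phi(x,y,z)$ ($\mu$ denotes the bracket of $\mathfrak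 g$). Let $\mathfrak C^{n+1}(V,\mathfrak g)=\mathrm{Hom}((\otimes^2V)^{\otimes n}\otimes V,\mathfrak g)$, $n\ge 0$, in degree $n$, regarded as a subspace of $\mathfrak C^{n+1}(W,W)$ (extension by zero on arguments having a $\mathfrak g$-component), and let $\mathrm{Pr}:\mathfrak C^{\ast}(W,W)\to\mathfrak C^\ast(V,\mathfrak g)$ be the projection (restrict all arguments to $V$ and take the $\mathfrak g$-component of the value). For $P,Q,R,S\in\mathfrak C^\ast(V,\mathfrak g)$ put $l_3(P,Q,R)=\mathrm{Pr}\,[[[\Omega,P]_{\mathrm{3Leib}},Q]_{\mathrm{3Leib}},R]_{\mathrm{3Leib}}$ and $l_4(P,Q,R,S)=\mathrm{Pr}\,[[[[\Omega,P]_{\mathrm{3Leib}},Q]_{\mathrm{3Leib}},R]_{\mathrm{3Leib}},S]_{\mathrm{3Leib}}$. Convention: an $L_\infty$-algebra is a graded vector space with graded symmetric degree-$1$ multilinear maps $l_k$ ($k\ge1$) such that for all $n\ge1$ and homogeneous $x_1,\dots,x_n$, $\sum_{i=1}^n\sum_{\sigma\in S(i,n-i)}\varepsilon(\sigma)\,l_{n-i+1}(l_i(x_{\sigma(1)},\dots,x_{\sigma(i)}),x_{\sigma(i+1)},\dots,x_{\sigma(n)})=0$, with $\varepsilon(\sigma)$ the Koszul sign. A Maurer-Cartan element is a degree-$0$ element $x$ with $\sum_k\frac1{k!}l_k(x,\dots,x)=0$. *)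

(* Defs.v *)
From HB Require Import structures.
From mathcomp Require Import all_boot all_order all_algebra all_fingroup.
From mathcomp Require Import boolp classical_sets functions.

Set Implicit Arguments.
Unset Strict Implicit.
Unset Printing Implicit Defensive.

Import GRing.Theory.
Local Open Scope ring_scope.

(** * 3-Leibniz algebras, representations, 2-cocycles *)

Record trilinear (K : fieldType) (A B C D : lmodType K) (f : A -> B -> C -> D)
    : Prop := Trilinear {
  trilinear1 : forall y z (k : K) x x',
    f (k *: x + x') y z = k *: f x y z + f x' y z;
  trilinear2 : forall x z (k : K) y y',
    f x (k *: y + y') z = k *: f x y z + f x y' z;
  trilinear3 : forall x y (k : K) z z',
    f x y (k *: z + z') = k *: f x y z + f x y z' }.

Record is_3Leibniz (K : fieldType) (g : lmodType K) (br : g -> g -> g -> g)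
    : Prop := Is3Leibniz {
  leib_trilinear : trilinear br;
  leib_identity : forall a b x y z,
    br a b (br x y z)
    = br (br a b x) y z + br x (br a b y) z + br x y (br a b z) }.

Record is_representation (K : fieldType) (g V : lmodType K)
    (br : g -> g -> g -> g)
    (rl : g -> g -> V -> V) (rm : g -> V -> g -> V) (rr : V -> g -> g -> V)
    : Prop := IsRepresentation {
  rep_l : trilinear rl;
  rep_m : trilinear rm;
  rep_r : trilinear rr;
  rep_ll : forall a b x y u,
    rl a b (rl x y u)
    = rl (br a b x) y u + rl x (br a b y) u + rl x y (rl a b u);
  rep_lm : forall a b x u z,
    rl a b (rm x u z)
    = rm (br a b x) u z + rm x (rl a b u) z + rm x u (br a b z);
  rep_lr : forall a b u y z,
    rl a b (rr u y z)
    = rr (rl a b u) y z + rr u (br a b y) z + rr u y (br a b z);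
  rep_mb : forall a u x y z,
    rm a u (br x y z)
    = rr (rm a u x) y z + rm x (rm a u y) z + rl x y (rm a u z);
  rep_rb : forall u b x y z,
    rr u b (br x y z)
    = rr (rr u b x) y z + rm x (rr u b y) z + rl x y (rr u b z) }.

Record is_2cocycle (K : fieldType) (g V : lmodType K)
    (br : g -> g -> g -> g)
    (rl : g -> g -> V -> V) (rm : g -> V -> g -> V) (rr : V -> g -> g -> V)
    (Phi : g -> g -> g -> V) : Prop := Is2Cocycle {
  coc_trilinear : trilinear Phi;
  coc_identity : forall a b x y z,
    Phi a b (br x y z) + rl a b (Phi x y z)
    = Phi (br a b x) y z + Phi x (br a b y) z + Phi x y (br a b z)
      + rl x y (Phi a b z) + rm x (Phi a b y) z + rr (Phi a b x) y z }.

Definition is_twisted_RB (K : fieldType) (g V : lmodType K)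
    (br : g -> g -> g -> g)
    (rl : g -> g -> V -> V) (rm : g -> V -> g -> V) (rr : V -> g -> g -> V)
    (Phi : g -> g -> g -> V) (T : {linear V -> g}) : Prop :=
  forall u v w : V,
    br (T u) (T v) (T w)
    = T (rl (T u) (T v) w + rm (T u) v (T w) + rr u (T v) (T w)
         + Phi (T u) (T v) (T w)).

(** * Permutations, shuffles, Koszul signs *)

(* [S(i, n - i)], with the positions 1, ..., n shifted to 0, ..., n - 1 *)
Definition shuffle (n i : nat) (s : 'S_n) : bool :=
  [forall a : 'I_n, forall b : 'I_n,
    [&& (a < b)%N & (b < i)%N || (i <= a)%N] ==> (s a < s b)%N].

(* [x_0, ..., x_(n-1) |-> x_(s 0), ..., x_(s (n-1))] *)
Definition permuted (X : Type) (n : nat) (s : 'S_n) (x : 'I_n -> X) : seq X :=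
  [seq x (s i) | i <- enum 'I_n].

Definition koszul (K : fieldType) (n : nat) (d : 'I_n -> int) (s : 'S_n) : K :=
  \prod_(a < n) \prod_(b < n | (a < b)%N && (s b < s a)%N)
     (-1) ^ (d (s a) * d (s b)).

(** * L-infinity algebras *)

(* A graded vector space is given by its homogeneous components [L d], d in Z,
   which are subspaces of a common ambient space E, in direct sum. *)
Record graded_subspace (K : fieldType) (E : lmodType K) (L : int -> set E)
    : Prop := GradedSubspace {
  grs_zero : forall d, L d 0;
  grs_lin : forall d (k : K) x y, L d x -> L d y -> L d (k *: x + y);
  grs_direct : forall (ds : seq int) (x : int -> E), uniq ds ->
    (forall d, L d (x d)) -> \sum_(d <- ds) x d = 0 ->
    forall d, d \in ds -> x d = 0 }.

Definition direct_sum (K : fieldType) (E : lmodType K) (L : int -> set E)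
    : set E :=
  [set y | exists (ds : seq int) (x : int -> E),
     (forall d, L d (x d)) /\ y = \sum_(d <- ds) x d].

(* The operations are packed in one function on lists: [l_k (x_1, ..., x_k)]
   is [l [:: x_1; ...; x_k]].  The value of [l] at the empty list, and its
   values outside the direct sum of the [L d], are irrelevant. *)
Record is_Linfty (K : fieldType) (E : lmodType K) (L : int -> set E)
    (l : seq E -> E) : Prop := IsLinfty {
  linf_graded : graded_subspace L;
  linf_multilinear : forall (s1 s2 : seq E) (k : K) (x y : E),
    (forall z, z \in s1 ++ s2 -> direct_sum L z) ->
    direct_sum L x -> direct_sum L y ->
    l (s1 ++ (k *: x + y) :: s2) = k *: l (s1 ++ x :: s2) + l (s1 ++ y :: s2);
  linf_degree : forall (n : nat) (d : 'I_n -> int) (x : 'I_n -> E),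
    (0 < n)%N -> (forall i, L (d i) (x i)) ->
    L (\sum_i d i + 1) (l [seq x i | i <- enum 'I_n]);
  linf_symmetric : forall (n : nat) (d : 'I_n -> int) (x : 'I_n -> E)
      (s : 'S_n), (0 < n)%N -> (forall i, L (d i) (x i)) ->
    l (permuted s x) = koszul K d s *: l [seq x i | i <- enum 'I_n];
  linf_jacobi : forall (n : nat) (d : 'I_n -> int) (x : 'I_n -> E),
    (0 < n)%N -> (forall i, L (d i) (x i)) ->
    \sum_(1 <= i < n.+1) \sum_(s : 'S_n | shuffle i s)
      koszul K d s *: l (l (take i (permuted s x)) :: drop i (permuted s x))
    = 0 }.

(* The Maurer-Cartan series is required to have finitely many nonzero terms. *)
Definition is_maurer_cartan (K : fieldType) (E : lmodType K)
    (L : int -> set E) (l : seq E -> E) (x : E) : Prop :=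
  L 0 x /\
  exists N : nat, (forall k, (N <= k)%N -> l (nseq k x) = 0) /\
    \sum_(1 <= k < N) (k`!%:R : K)^-1 *: l (nseq k x) = 0.

(** * Cochains *)

(* An element of the sum over n of [Hom ((W (x) W)^(x)n (x) W, U)] is a
   function taking the list [X_1; ...; X_n] of pairs [X_i = (x_i, y_i)] and the
   last argument; its component of degree n is its restriction to lists of
   length n. *)
Notation cochains W U := (seq (W * W) -> W -> U) (only parsing).

Record multilinear (K : fieldType) (W U : lmodType K) (P : cochains W U)
    : Prop := Multilinear {
  multilinear_fst : forall s1 s2 (k : K) (x x' y z : W),
    P (s1 ++ (k *: x + x', y) :: s2) z
    = k *: P (s1 ++ (x, y) :: s2) z + P (s1 ++ (x', y) :: s2) z;
  multilinear_snd : forall s1 s2 (k : K) (x y y' z : W),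
    P (s1 ++ (x, k *: y + y') :: s2) z
    = k *: P (s1 ++ (x, y) :: s2) z + P (s1 ++ (x, y') :: s2) z;
  multilinear_last : forall s (k : K) (z z' : W),
    P s (k *: z + z') = k *: P s z + P s z' }.

(* the component of degree d; it is zero for d < 0 *)
Definition cochain (K : fieldType) (W U : lmodType K) (d : int)
    : set (cochains W U) :=
  [set P | multilinear P /\ forall s z, (size s)%:Z != d -> P s z = 0].

(** * The graded Lie bracket *)

Section Bracket.
Variables (K : fieldType) (W : lmodType K).
Implicit Types (P Q : cochains W W) (s : seq (W * W)).

Definition perm_args (n : nat) (sg : 'S_n) s : seq (W * W) :=
  permuted sg (fun i : 'I_n => nth (0, 0) s i).

(* [P o Q] for P of degree p and Q of degree q, on a list s of length p + q;
   the index j is k - 1. *)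
Definition circ (p q : nat) P Q : cochains W W := fun s x =>
  \sum_(j < p) ((-1) ^+ (j * q) : K) *:
    (\sum_(sg : 'S_(j + q) | shuffle j sg) ((-1) ^+ sg : K) *:
      (let t := perm_args sg s in
       let X := nth (0, 0) s (j + q) in
       P (take j t ++ (Q (drop j t) X.1, X.2) :: drop (j + q).+1 s) x))
  + \sum_(j < p) ((-1) ^+ (j * q) : K) *:
    (\sum_(sg : 'S_(j + q) | shuffle j sg) ((-1) ^+ sg : K) *:
      (let t := perm_args sg s in
       let X := nth (0, 0) s (j + q) in
       P (take j t ++ (X.1, Q (drop j t) X.2) :: drop (j + q).+1 s) x))
  + \sum_(sg : 'S_(p + q) | shuffle p sg) ((-1) ^+ (p * q) * (-1) ^+ sg : K) *:
      (let t := perm_args sg s in P (take p t) (Q (drop p t) x)).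

(* The bilinear extension of [P o Q - (-1)^(p q) Q o P] to inhomogeneous
   elements: on a list of length n, sum over p + q = n.  Only values of P on
   lists of length p and of Q on lists of length q enter the (p, q) term. *)
Definition bracket P Q : cochains W W := fun s x =>
  \sum_(p < (size s).+1)
    (circ p (size s - p) P Q s x
     - ((-1) ^+ (p * (size s - p)) : K) *: circ (size s - p) p Q P s x).

End Bracket.

(** * Derived brackets on [C^*(V, g)] *)

Section DerivedBrackets.
Variables (K : fieldType) (g V : lmodType K).
Variables (br : g -> g -> g -> g)
  (rl : g -> g -> V -> V) (rm : g -> V -> g -> V) (rr : V -> g -> g -> V)
  (Phi : g -> g -> g -> V).

Local Notation W := (g * V)%type.

Definition Omega : cochains W W := fun s z =>
  match s with
  | [:: (x, y)] =>
      (br x.1 y.1 z.1,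
       rl x.1 y.1 z.2 + rm x.1 y.2 z.1 + rr x.2 y.1 z.1 + Phi x.1 y.1 z.1)
  | _ => 0
  end.

Definition incl (P : cochains V g) : cochains W W := fun s z =>
  (P [seq (X.1.2, X.2.2) | X <- s] z.2, 0).

Definition Pr (F : cochains W W) : cochains V g := fun s v =>
  (F [seq ((0, X.1), (0, X.2)) | X <- s] (0, v)).1.

Definition l3 (P Q R : cochains V g) : cochains V g :=
  Pr (bracket (bracket (bracket Omega (incl P)) (incl Q)) (incl R)).

Definition l4 (P Q R R' : cochains V g) : cochains V g :=
  Pr (bracket (bracket (bracket (bracket Omega (incl P)) (incl Q)) (incl R))
        (incl R')).

Definition linf_op (xs : seq (cochains V g)) : cochains V g :=
  match xs with
  | [:: P; Q; R] => l3 P Q R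
  | [:: P; Q; R; R'] => l4 P Q R R'
  | _ => 0
  end.

End DerivedBrackets.

(* a linear map as a cochain of degree 0 *)
Definition cochain_of_linear (K : fieldType) (g V : lmodType K)
    (T : {linear V -> g}) : cochains V g := fun s v =>
  if s is [::] then T v else 0.

(* Main.v *)
(* The L-infinity structure comes from Voronov's higher derived brackets: in the
   graded Lie algebra of cochains on [g + V], the subspace C(V, g) is abelian,
   the kernel of the projection onto it is a subalgebra, and the structure
   cochain Omega of the semidirect product twisted by Phi lies in this kernel
   and squares to zero.  Iterating the derivations [[-, x]] on
   [[Omega, Omega] = 0] and projecting gives the generalized Jacobi identities.

   The graded Jacobi identity for the shuffle bracket follows from a pre-Lie
   identity, proved by induction on the argument list once the shuffle sums are
   rewritten as a recursion on the first argument.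

   Counting arguments and values in V shows that only the brackets of arity 3
   and 4 are nonzero, and for an operator T the relation T o T = 0 on [g + V]
   lets one expand l_3(T,T,T) and l_4(T,T,T,T) explicitly. *)

(* Composing two shuffle formulas directly would require bookkeeping of products of shuffles. The
   recursion on the first pair avoids this: the pair goes to one of the factors, and the only
   exceptional case is a factor of degree 0, which receives no pair and acts on it as a derivation.
   In that case the sign [(-1) ^ (q * r)] is 1, so no separate sign analysis is needed. One
   recursion, [unshuffle_sum], serves twice: with all degrees 1 it gives the signatures in [circ],
   with the degrees of the cochains it gives the Koszul signs of the Jacobi identities. The
   operations [linf_op] are zero by definition outside arities 3 and 4, so the derived-bracket
   construction applies only once the other derived brackets are known to vanish. Weights are read
   off as eigenvalues of a dilation, which turns the count of slots into a comparison of powers of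
   2. Characteristic 0 enters three times: each Jacobi sum is obtained doubled, distinct powers of 2
   must differ in [K], and 3! and 4! must be invertible. These factorials cancel the 6 and 24 that
   arise from iterating a sum of four commuting operations of square zero. *)
Require Import Defs.
From mathcomp Require Import all_boot all_order all_algebra all_fingroup.
From mathcomp Require Import boolp classical_sets functions.
From mathcomp Require Import ring zify.

Set Implicit Arguments.
Unset Strict Implicit.
Unset Printing Implicit Defensive.

Import Order.TTheory GRing.Theory Num.Theory.
Local Open Scope ring_scope.
Local Notation incl := Defs.incl.

(** * Linear identities in modules, by reflection *)

Section LinearExpressions.
Variables (K : pzRingType) (V : lmodType K).

Inductive lexpr : Type :=
| LVar of nat
| LZero
| LAdd of lexpr & lexpr
| LOpp of lexpr
| LScale of K & lexpr.

Fixpoint leval (env : seq V) (e : lexpr) : V :=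
  match e with
  | LVar i => nth 0 env i
  | LZero => 0
  | LAdd e1 e2 => leval env e1 + leval env e2
  | LOpp e1 => - leval env e1
  | LScale c e1 => c *: leval env e1
  end.

Fixpoint lcoef (e : lexpr) (i : nat) : K :=
  match e with
  | LVar j => if j == i then 1 else 0
  | LZero => 0
  | LAdd e1 e2 => lcoef e1 i + lcoef e2 i
  | LOpp e1 => - lcoef e1 i
  | LScale c e1 => c * lcoef e1 i
  end.

Lemma leval_coef env e :
  leval env e = \sum_(i < size env) lcoef e i *: nth 0 env i.
Proof.
elim: e => [j||e1 IH1 e2 IH2|e1 IH1|c e1 IH1] /=.
- have [lt_j|le_j] := ltnP j (size env).
    rewrite (bigD1 (Ordinal lt_j)) //= eqxx scale1r big1 ?addr0 // => i.
    by rewrite -val_eqE /= eq_sym => /negPf->; rewrite scale0r.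
  rewrite nth_default // big1 // => i _; case: eqP => [ji|_].
    by move: (ltn_ord i); rewrite -ji ltnNge le_j.
  by rewrite scale0r.
- by rewrite big1 // => i _; rewrite scale0r.
- by rewrite IH1 IH2 -big_split; apply: eq_bigr => i _; rewrite scalerDl.
- by rewrite IH1 -sumrN; apply: eq_bigr => i _; rewrite scaleNr.
- by rewrite IH1 scaler_sumr; apply: eq_bigr => i _; rewrite scalerA.
Qed.

Fixpoint lsame (n : nat) (e1 e2 : lexpr) : Prop :=
  if n is n'.+1 then lcoef e1 n' = lcoef e2 n' /\ lsame n' e1 e2 else True.

Lemma lsameP env e1 e2 :
  lsame (size env) e1 e2 -> leval env e1 = leval env e2.
Proof.
move=> same; rewrite !leval_coef; apply: eq_bigr => -[i lt_i] _ /=.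
congr (_ *: _); elim: (size env) lt_i same => // n IHn.
by rewrite ltnS leq_eqVlt => /predU1P[->|/IHn same_i] [].
Qed.

End LinearExpressions.

(* Atoms are compared up to unification: inferred structures on the same type
   need not be syntactically equal. *)
Ltac lmod_same x y :=
  match constr:(Set) with
  | _ => let _ := match constr:(Set) with _ => constr_eq x y end in
         constr:(true)
  | _ => let _ := match constr:(Set) with _ => unify x y end in
         constr:(true)
  | _ => constr:(false)
  end.
Ltac lmod_index x env :=
  lazymatch env with
  | cons ?y ?env' =>
      lazymatch lmod_same x y with
      | true => constr:(O)
      | false => let i := lmod_index x env' in constr:(S i)
      end
  end.
Ltac lmod_mem x env :=
  lazymatch env with
  | nil => constr:(false)
  | cons ?y ?env' =>
      lazymatch lmod_same x y with
      | true => constr:(true)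
      | false => lmod_mem x env'
      end
  end.
Ltac lmod_env t env :=
  lazymatch t with
  | GRing.add ?a ?b => let env' := lmod_env a env in lmod_env b env'
  | GRing.opp ?a => lmod_env a env
  | GRing.scale _ ?a => lmod_env a env
  | GRing.zero => env
  | _ => lazymatch lmod_mem t env with
         | true => env
         | false => constr:(cons t env)
         end
  end.
Ltac lmod_reify K t env :=
  lazymatch t with
  | GRing.add ?a ?b =>
      let a' := lmod_reify K a env in let b' := lmod_reify K b env in
      constr:(LAdd a' b')
  | GRing.opp ?a => let a' := lmod_reify K a env in constr:(LOpp a')
  | GRing.scale ?c ?a =>
      let a' := lmod_reify K a env in constr:(@LScale K c a')
  | GRing.zero => constr:(LZero K)
  | _ => let i := lmod_index t env in constr:(LVar K i)
  end.
(* [lmod K V] reduces an equation in the [K]-module [V] to one ring identity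
   per atom and tries [ring] on each. *)
Ltac lmod K V :=
  lazymatch goal with
  | |- ?a = ?b =>
      let env := lmod_env a constr:(@nil V) in
      let env := lmod_env b env in
      let a' := lmod_reify K a env in
      let b' := lmod_reify K b env in
      refine (@lsameP K V env a' b' _);
      cbn [lsame lcoef size eqn eq_op]; repeat split; rewrite /=; try ring
  end.

(** * Shuffles *)

Section Unshuffle.
Variables (K : fieldType) (X : Type) (deg : X -> int).

Definition degs (s : seq X) : int := \sum_(x <- s) deg x.

Lemma degs_cons x s : degs (x :: s) = deg x + degs s.
Proof. exact: big_cons. Qed.

(* The Koszul-signed sum of [F A B] over all ways of splitting [s] into
   complementary subsequences [A] and [B]: an element sent to [B] jumps over the
   part of [A] that follows it. *)
Fixpoint unshuffle_sum (E : lmodType K) (F : seq X -> seq X -> E) (s : seq X)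
    : E :=
  if s is x :: s' then
    unshuffle_sum (fun A B => F (x :: A) B) s' +
    unshuffle_sum (fun A B => (-1) ^ (deg x * degs A) *: F A (x :: B)) s'
  else F [::] [::].

End Unshuffle.

Section Shuffles.

(** Permutations are sorted by the place [j] that receives the first argument; this is the source of
    every recursion on the first argument below. *)
Lemma sum_lift_perm (E : nmodType) n (P : pred 'S_n.+1) (G : 'S_n.+1 -> E) :
  \sum_(sg | P sg) G sg =
  \sum_j \sum_(s : 'S_n | P (lift_perm j ord0 s)) G (lift_perm j ord0 s).
Proof.
rewrite (partition_big (fun sg : 'S_n.+1 => sg^-1%g ord0) predT) //=.
apply: eq_bigr => j _; rewrite (reindex (lift_perm j ord0)); last first.
  (* [ulsf i s] is [s] with the point [i] and its image removed, the inverse of [lift_perm]; the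
     default [k] is never reached. *)
  pose ulsf i (s : 'S_n.+1) k := odflt k (unlift (s i) (s (lift i k))).
  have ulsfK i (s : 'S_n.+1) k: lift (s i) (ulsf i s k) = s (lift i k).
    rewrite /ulsf; have := neq_lift i k.
    by rewrite -(can_eq (permK s)) => /unlift_some[] ? ? ->.
  have inj_ulsf: injective (ulsf j _).
    move=> s; apply: can_inj (ulsf (s j) s^-1%g) _ => k'.
    by rewrite {1}/ulsf ulsfK !permK liftK.
  exists (fun s => perm (inj_ulsf s)) => [s _ | s].
    by apply/permP => k'; rewrite permE /ulsf lift_perm_lift lift_perm_id liftK.
  move=> /andP[_ /eqP sj]; have {}sj : s j = ord0 by rewrite -sj permKV.
  apply/permP => k; case: (unliftP j k) => [k'|] ->; rewrite ?lift_perm_id //.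
  by rewrite lift_perm_lift -{1}sj permE ulsfK.
apply: eq_bigl => s; rewrite (_ : _ == j) ?andbT //.
by apply/eqP; apply: (can_inj (permK (lift_perm j ord0 s)));
   rewrite permKV lift_perm_id.
Qed.

Lemma shuffleP n i (s : 'S_n) :
  reflect (forall a b : 'I_n, (a < b)%N -> (b < i)%N || (i <= a)%N ->
             (s a < s b)%N)
          (shuffle i s).
Proof.
apply: (iffP forallP) => [H a b ab abi | H a].
  by have /forallP/(_ b)/implyP := H a; apply; rewrite ab abi.
by apply/forallP => b; apply/implyP => /andP[]; apply: H.
Qed.

Lemma shuffle_lift0 n i (s : 'S_n) :
  shuffle i.+1 (lift_perm ord0 ord0 s) = shuffle i s.
Proof.
apply/shuffleP/shuffleP => H a b.
  by move=> ab abi; have := H (lift ord0 a) (lift ord0 b);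
     rewrite !lift_perm_lift !lift0 !ltnS; apply.
case: (unliftP ord0 a) => [a'|] ->; case: (unliftP ord0 b) => [b'|] -> //.
  by rewrite !lift_perm_lift !lift0 !ltnS; apply: H.
by move=> _ _; rewrite lift_perm_id lift_perm_lift.
Qed.

Lemma shuffle_lift n (i : 'I_n.+1) (s : 'S_n) :
  shuffle i (lift_perm i ord0 s) = shuffle i s.
Proof.
apply/shuffleP/shuffleP => H a b.
  move=> ab abi; have := H (lift i a) (lift i b).
  by rewrite !lift_perm_lift !lift0 !ltnS; apply; rewrite /= /bump; lia.
case: (unliftP i a) => [a'|] ->; case: (unliftP i b) => [b'|] -> //.
- rewrite !lift_perm_lift !lift0 !ltnS /= => ab abi; apply: H; move: ab abi.
    by rewrite /bump; lia.
  by rewrite /bump; lia.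
- by rewrite /= /bump; lia.
- by rewrite lift_perm_id lift_perm_lift.
- by rewrite ltnn.
Qed.

(** The least value must head one of the two increasing blocks, which start at the places 0 and
    [i]. *)
Lemma shuffle_lift_out n i (j : 'I_n.+1) (s : 'S_n) :
  j != ord0 -> j != i :> nat -> shuffle i (lift_perm j ord0 s) = false.
Proof.
move=> j0 ji; apply/negP => /shuffleP H.
have j_gt0 : (0 < j)%N by rewrite lt0n.
have [lt_ji|le_ij] := ltnP j i.
  by have := H ord0 j j_gt0; rewrite lt_ji lift_perm_id ltn0 => /(_ isT).
have lt_ij : (i < j)%N by rewrite ltn_neqAle eq_sym ji.
have := H (Ordinal (ltn_trans lt_ij (ltn_ord j))) j lt_ij.
by rewrite leqnn orbT lift_perm_id ltn0 => /(_ isT).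
Qed.

(** The value 0 at place [j] forms an inversion with exactly the places before [j]; all other
    inversions are those of [s]. *)
Lemma koszul_lift (K : fieldType) n (d : 'I_n.+1 -> int) (j : 'I_n.+1)
    (s : 'S_n) :
  koszul K d (lift_perm j ord0 s) =
  (\prod_(a < n | (a < j)%N) (-1) ^ (d (lift ord0 (s a)) * d ord0))
    * koszul K (d \o lift ord0) s.
Proof.
have koszulE m e (t : 'S_m) : koszul K e t = \prod_(a < m) \prod_(b < m)
    if (a < b)%N && (t b < t a)%N then (-1) ^ (e (t a) * e (t b)) else 1.
  by apply: eq_bigr => a _; rewrite -big_mkcond.
have lift_lt (a b : 'I_n) : (lift j a < lift j b)%N = (a < b)%N.
  by rewrite /= /bump; lia.
have lift_ltj (a : 'I_n) : (lift j a < j)%N = (a < j)%N.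
  by rewrite /= /bump; lia.
have inv_j : \prod_(b < n.+1) (if (j < b)%N &&
    (lift_perm j ord0 s b < lift_perm j ord0 s j)%N
    then (-1) ^ (d (lift_perm j ord0 s j) * d (lift_perm j ord0 s b)) else 1)
    = 1 :> K.
  by apply: big1 => b _; rewrite lift_perm_id ltn0 andbF.
rewrite !koszulE (bigD1_ord j) //= inv_j mul1r {inv_j}.
rewrite [X in X * _]big_mkcond -big_split; apply: eq_bigr => a _.
rewrite (bigD1_ord j) // lift_ltj lift_perm_id lift_perm_lift.
rewrite (_ : (ord0 < _)%N) ?lift0 // andbT; congr (_ * _).
by apply: eq_bigr => b _; rewrite lift_lt !lift_perm_lift !lift0 ltnS.
Qed.

Lemma lift_perm_ord0P n (s : 'S_n.+1) :
  exists j (s' : 'S_n), s = lift_perm j ord0 s'.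
Proof.
(* Surjectivity by counting: the indicator of [s] sums to 1, so some [lift_perm j ord0 s'] must
   equal [s]. *)
have /eqP := @sum_lift_perm nat n (pred1 s) (fun=> 1%N).
rewrite big_pred1_eq eq_sym => /eqP sum1.
have [/existsP[j /existsP[s' /eqP eq_s]]|] :=
  boolP [exists j, exists s' : 'S_n, lift_perm j ord0 s' == s].
  by exists j, s'.
rewrite negb_exists => /forallP no_s; move: sum1; rewrite big1 // => j _.
rewrite big1 // => s' /= eq_s; have /negP[] := no_s j.
by apply/existsP; exists s'.
Qed.

Lemma size_permuted (X : Type) n (s : 'S_n) (x : 'I_n -> X) :
  size (permuted s x) = n.
Proof. by rewrite size_map size_enum_ord. Qed.

Lemma nth_permuted (X : Type) n (s : 'S_n) (x : 'I_n -> X) x0 (k : 'I_n) :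
  nth x0 (permuted s x) k = x (s k).
Proof.
rewrite (nth_map k) ?size_enum_ord //; congr (x (s _)).
by apply: val_inj; rewrite /= nth_enum_ord.
Qed.

Lemma degs_take_permuted (X : Type) (deg : X -> int) n (s : 'S_n)
    (x : 'I_n -> X) j :
  (j <= n)%N ->
  degs deg (take j (permuted s x)) = \sum_(a < n | (a < j)%N) deg (x (s a)).
Proof.
case: n s x => [|n] s x le_jn.
  by rewrite big_ord0 /permuted enum_ord0 /degs big_nil.
rewrite big_ord_narrow /degs (big_nth (x ord0)) size_takel ?size_permuted //.
rewrite big_mkord; apply: eq_bigr => i _; rewrite nth_take //.
by rewrite -(nth_permuted s x (x ord0)).
Qed.

Lemma expN1D (K : fieldType) (m n : int) :
  (-1) ^ (m + n) = (-1) ^ m * (-1) ^ n :> K.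
Proof. by rewrite expfzDr // oppr_eq0 oner_eq0. Qed.

Lemma expN1_sum (K : fieldType) (I : Type) (r : seq I) (P : pred I)
    (F : I -> int) :
  (-1) ^ (\sum_(i <- r | P i) F i) = \prod_(i <- r | P i) (-1) ^ F i :> K.
Proof. by apply: (big_morph _ (expN1D K)). Qed.

Lemma koszul_lift_degs (K : fieldType) (X : Type) (deg : X -> int) n
    (x : 'I_n.+1 -> X) (j : 'I_n.+1) (s : 'S_n) :
  koszul K (deg \o x) (lift_perm j ord0 s) =
  (-1) ^ (deg (x ord0) * degs deg (take j (permuted s (x \o lift ord0))))
    * koszul K ((deg \o x) \o lift ord0) s.
Proof.
rewrite koszul_lift; congr (_ * _); rewrite degs_take_permuted -1?ltnS //.
by rewrite mulr_sumr expN1_sum; apply: eq_bigr => a _; rewrite mulrC.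
Qed.

Lemma degs1 (X : Type) (s : seq X) : degs (fun=> 1) s = (size s)%:Z.
Proof. by elim: s => [|x s IHs]; rewrite ?degs_cons ?IHs // /degs big_nil. Qed.

(** This lets [shuffle_sumE], stated for Koszul signs, also handle the signatures in the formula for
    [circ]. *)
Lemma koszul1 (K : fieldType) n (s : 'S_n) :
  koszul K (fun=> 1) s = (-1) ^+ s.
Proof.
elim: n s => [|n IHn] s; first by rewrite /koszul big_ord0 permS0 odd_perm1.
have [j [s' ->]] := lift_perm_ord0P s.
rewrite (koszul_lift_degs _ (fun=> 1) id) degs1 size_takel ?size_permuted //.
rewrite IHn odd_lift_perm /= addbF signr_addb signr_odd mul1r //.
by rewrite -ltnS.
Qed.

Lemma permuted_lift (X : Type) n (j : 'I_n.+1) (s : 'S_n) (x : 'I_n.+1 -> X) :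
  permuted (lift_perm j ord0 s) x =
  let t := permuted s (x \o lift ord0) in take j t ++ x ord0 :: drop j t.
Proof.
move=> /=; have sz := size_permuted s (x \o lift ord0).
apply: (@eq_from_nth _ (x ord0)).
  rewrite size_cat /= size_take size_drop sz size_map size_enum_ord.
  by have := ltn_ord j; rewrite ltnS; case: ltnP; lia.
rewrite size_map size_enum_ord => i lt_i.
rewrite -[i in LHS]/(val (Ordinal lt_i)) nth_permuted.
have sz_t : size (take j (permuted s (x \o lift ord0))) = j.
  by rewrite size_takel // sz -ltnS.
rewrite nth_cat sz_t.
case: (unliftP j (Ordinal lt_i)) => [k|] /(congr1 val) /= ik.
  have -> : Ordinal lt_i = lift j k by apply: val_inj.
  rewrite lift_perm_lift -[x _]/((x \o lift ord0) (s k)).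
  rewrite -(nth_permuted s (x \o lift ord0) (x ord0)) ik /bump.
  have [le_jk|lt_kj] := leqP j k; last by rewrite add0n lt_kj nth_take.
  by rewrite add1n ltnNge (leqW le_jk) subSn //= nth_drop subnKC.
have -> : Ordinal lt_i = j by apply: val_inj.
by rewrite lift_perm_id ik ltnn subnn.
Qed.

End Shuffles.

Section ShuffleSums.
Variables (K : fieldType) (X : Type) (deg : X -> int) (E : lmodType K).
Implicit Types (F G : seq X -> seq X -> E).

Lemma eq_unshuffle_size F G s :
  (forall A B, (size A + size B)%N = size s -> F A B = G A B) ->
  unshuffle_sum deg F s = unshuffle_sum deg G s.
Proof.
elim: s F G => [|x s IHs] F G eqFG /=; first exact: eqFG.
congr (_ + _); apply: IHs => A B sz; first by apply: eqFG; rewrite /= addSn sz.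
by rewrite eqFG //= addnS sz.
Qed.

Lemma unshuffle0 s : unshuffle_sum deg (fun _ _ => 0 : E) s = 0.
Proof.
elim: s => //= x s IHs; rewrite IHs add0r -[RHS]IHs; apply: eq_unshuffle_size.
by move=> A B _; rewrite scaler0.
Qed.

Lemma unshuffleZ (k : K) F s :
  unshuffle_sum deg (fun A B => k *: F A B) s = k *: unshuffle_sum deg F s.
Proof.
elim: s F => //= x s IHs F; rewrite scalerDr -!IHs; congr (_ + _).
by apply: eq_unshuffle_size => A B _; rewrite !scalerA mulrC.
Qed.

(** Induction on [n] by the place [j] of the first argument: heading the first block is the [A]
    branch of [unshuffle_sum], heading the second block is the [B] branch, and no other place occurs
    in a shuffle. *)
Lemma shuffle_sumE n (x : 'I_n -> X) i F : (i <= n)%N ->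
  \sum_(s : 'S_n | shuffle i s) koszul K (deg \o x) s *:
     F (take i (permuted s x)) (drop i (permuted s x)) =
  unshuffle_sum deg (fun A B => if size A == i then F A B else 0)
    [seq x k | k <- enum 'I_n].
Proof.
elim: n x i F => [|n IHn] x i F.
  rewrite leqn0 => /eqP->; rewrite (big_pred1 1%g) => [|s]; last first.
    by rewrite permS0 [RHS]eqxx; apply/shuffleP => -[].
  by rewrite /permuted enum_ord0 /koszul big_ord0 scale1r.
move=> le_i; rewrite enum_ordSl /= -map_comp sum_lift_perm.
pose G j := \sum_(s : 'S_n | shuffle i (lift_perm j ord0 s))
  koszul K (deg \o x) (lift_perm j ord0 s) *:
  F (take i (permuted (lift_perm j ord0 s) x))
    (drop i (permuted (lift_perm j ord0 s) x)).
have G0 : (0 < i)%N -> G ord0 = unshuffle_sum deg (fun A B =>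
    if size (x ord0 :: A) == i then F (x ord0 :: A) B else 0)
    [seq x (lift ord0 k) | k <- enum 'I_n].
  case: i le_i @G => // i le_i G _; rewrite /G.
  rewrite (eq_bigl _ _ (@shuffle_lift0 _ _)).
  rewrite -(IHn (x \o lift ord0) i (fun A B => F (x ord0 :: A) B)) -1?ltnS //.
  apply: eq_bigr => s _; rewrite permuted_lift koszul_lift_degs /= take0 drop0.
  by rewrite /degs big_nil mulr0 mul1r.
have Gi (i' : 'I_n.+1) : i = i' :> nat -> G i' = unshuffle_sum deg (fun A B =>
    (-1) ^ (deg (x ord0) * degs deg A) *:
    (if size A == i then F A (x ord0 :: B) else 0))
    [seq x (lift ord0 k) | k <- enum 'I_n].
  move=> ii'; rewrite /G ii'; have le_i'n : (i' <= n)%N by rewrite -ltnS.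
  rewrite (eq_bigl _ _ (@shuffle_lift _ _)).
  transitivity (unshuffle_sum deg (fun A B => if size A == i' then
      (-1) ^ (deg (x ord0) * degs deg A) *: F A (x ord0 :: B) else 0)
    [seq (x \o lift ord0) k | k <- enum 'I_n]); last first.
    by apply: eq_unshuffle_size => A B _; case: ifP; rewrite ?scaler0.
  rewrite -IHn //; apply: eq_bigr => s _.
  rewrite permuted_lift koszul_lift_degs.
  rewrite scalerA mulrC /=; set t := permuted s _.
  have sz_t : size (take i' t) = i' by rewrite size_takel ?size_permuted.
  by rewrite take_size_cat ?drop_size_cat.
have Gout j : j != ord0 -> j != i :> nat -> G j = 0.
  by move=> j0 ji; apply: big_pred0 => s; apply: shuffle_lift_out.
(* Boundary cases: for [i = 0] the place 0 heads the second block, so only the [B] branch remains;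
   for [i = n.+1] the second block is empty, and the [B] branch is zero because no [A] drawn from
   the [n] remaining arguments is that long. *)
rewrite -/G; case: (posnP i) => [i0|i_gt0].
  rewrite (bigD1 ord0) //= -/(G ord0) big1 ?addr0 => [|j j0]; last first.
    by apply: Gout; rewrite ?i0.
  rewrite (Gi ord0) // i0 -[LHS]add0r; congr (_ + _).
  by rewrite -[LHS](unshuffle0 [seq x (lift ord0 k) | k <- enum 'I_n]).
rewrite (bigD1 ord0) //= -/(G ord0) G0 //; congr (_ + _).
have [lt_in|lt_ni] := ltnP i n.+1.
  rewrite (bigD1 (Ordinal lt_in)) /= -?/(G _) -1?lt0n // Gi // big1 ?addr0 //.
  by move=> j /andP[j0 ji]; apply: Gout.
rewrite big1 => [|j j0]; last first.
  by apply: Gout => //; rewrite neq_ltn (leq_trans (ltn_ord j)).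
rewrite -[LHS](unshuffle0 [seq x (lift ord0 k) | k <- enum 'I_n]).
apply: eq_unshuffle_size => A B sz.
case: eqP => [sz_A|_]; last by rewrite scaler0.
have : (size A <= n)%N.
  by move: sz; rewrite size_map size_enum_ord /= => <-; apply: leq_addr.
by rewrite sz_A leqNgt lt_ni.
Qed.
End ShuffleSums.

(** * The graded Lie algebra of cochains *)

Section FunctionModules.
Variables (K : pzRingType) (A B : Type) (U : lmodType K).
Implicit Types f g : A -> B -> U.

Lemma fun2D f g s z : (f + g) s z = f s z + g s z. Proof. by []. Qed.
Lemma fun2N f s z : (- f) s z = - f s z. Proof. by []. Qed.
Lemma fun2Z k f s z : (k *: f) s z = k *: f s z. Proof. by []. Qed.
Lemma fun20 s z : (0 : A -> B -> U) s z = 0. Proof. by []. Qed.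

Definition fun2E := (fun2D, fun2N, fun2Z, fun20).
End FunctionModules.

Definition ins (A B : Type) (X : A) (P : seq A -> B) : seq A -> B :=
  fun s => P (X :: s).

Section Multilinear.
Variables (K : fieldType) (W U : lmodType K).
Implicit Types (P Q : seq (W * W) -> W -> U) (X : W * W) (k : K).

Lemma multilinear_lin k P P' :
  multilinear P -> multilinear P' -> multilinear (k *: P + P').
Proof.
move=> [P1 P2 P3] [Q1 Q2 Q3]; split=> *; rewrite !fun2E.
- by rewrite P1 Q1; lmod K U.
- by rewrite P2 Q2; lmod K U.
- by rewrite P3 Q3; lmod K U.
Qed.

Lemma multilinear_ins X P : multilinear P -> multilinear (ins X P).
Proof.
by case=> P1 P2 P3; split=> *; rewrite /ins -?cat_cons ?P1 ?P2 ?P3.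
Qed.

Lemma multilinear0 : multilinear (0 : seq (W * W) -> W -> U).
Proof. by split=> *; rewrite !fun2E scaler0 addr0. Qed.

Lemma multilinear_last0 P s : multilinear P -> P s 0 = 0.
Proof.
by case=> _ _ P3; have := P3 s (-1) 0 0; rewrite !scaleN1r !addNr.
Qed.

Lemma multilinear_fst0 P s1 s2 y z : multilinear P ->
  P (s1 ++ (0, y) :: s2) z = 0.
Proof.
case=> P1 _ _; have := P1 s1 s2 (-1) 0 0 y z.
by rewrite !scaleN1r !addNr.
Qed.

Lemma multilinear_snd0 P s1 s2 y z : multilinear P ->
  P (s1 ++ (y, 0) :: s2) z = 0.
Proof.
case=> _ P2 _; have := P2 s1 s2 (-1) y 0 0 z.
by rewrite !scaleN1r !addNr.
Qed.

End Multilinear.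

(** * The recursive composition product *)

Section Composition.
Variables (K : fieldType) (W : lmodType K).
Local Notation C := (seq (W * W) -> W -> W).
Implicit Types (P Q R : C) (X : W * W) (s : seq (W * W)) (k : K).

(** The sign of a pair passing over [P]. Read off the length of the list, it needs no degree, so
    [comp] is defined on inhomogeneous cochains; on a homogeneous one it is a scalar ([altE]). *)
Definition alt P : C := fun s z => (-1) ^+ size s *: P s z.
Definition dins (T : W -> W) X P : C :=
  ins (T X.1, X.2) P + ins (X.1, T X.2) P.

Lemma dins_app T X P s z :
  dins T X P s z = P ((T X.1, X.2) :: s) z + P ((X.1, T X.2) :: s) z.
Proof. by []. Qed.

(* The product [P o Q], by recursion on the first pair [X]: either [X] goes to
   [P], passing over [Q], or it goes to [Q], or [Q] receives no pair at all and
   acts on [X] as a derivation. *)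
Fixpoint comp P Q s z {struct s} : W :=
  if s is X :: s' then
    comp (ins X P) (alt Q) s' z + comp P (ins X Q) s' z + dins (Q [::]) X P s' z
  else P [::] (Q [::] z).

Lemma multilinear_alt P : multilinear P -> multilinear (alt P).
Proof.
case=> P1 P2 P3; split=> *; rewrite /alt ?size_cat /=.
- by rewrite P1; lmod K W.
- by rewrite P2; lmod K W.
- by rewrite P3; lmod K W.
Qed.

Lemma dins0 X P : multilinear P -> dins (fun=> 0) X P = 0.
Proof.
move=> mP; apply/funext => s; apply/funext => z.
rewrite dins_app (multilinear_fst0 [::]) // (multilinear_snd0 [::]) //.
by rewrite addr0.
Qed.

Lemma dins_lin (T T' : W -> W) X k P s z : multilinear P ->
  dins (fun x => k *: T x + T' x) X P s z =
  k *: dins T X P s z + dins T' X P s z.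
Proof.
move=> [P1 P2 _]; rewrite !dins_app (P1 [::]) (P2 [::]) /=; lmod K W.
Qed.

Lemma comp_linl k P P' Q :
  comp (k *: P + P') Q = k *: comp P Q + comp P' Q.
Proof.
apply/funext => s; apply/funext => z; rewrite !fun2E.
elim: s P P' Q => [|X s IHs] P P' Q //=.
rewrite -[ins X (_ + _)]/(_ *: ins X P + ins X P') !IHs.
rewrite !dins_app !fun2E.
by lmod K W.
Qed.

Lemma comp_linr k P Q Q' : multilinear P ->
  comp P (k *: Q + Q') = k *: comp P Q + comp P Q'.
Proof.
move=> mP; apply/funext => s; apply/funext => z.
rewrite !fun2E.
elim: s P Q Q' mP => [|X s IHs] P Q Q' mP; first exact: multilinear_last.
rewrite /comp -/comp.
rewrite -[ins X (_ + _)]/(_ *: ins X Q + ins X Q').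
rewrite (_ : alt _ = k *: alt Q + alt Q'); last first.
  by apply/funext => t; apply/funext => v; rewrite /alt !fun2E /=; lmod K W.
rewrite !IHs //; last exact: multilinear_ins.
rewrite dins_lin //; lmod K W.
Qed.

Lemma compDl P P' Q : comp (P + P') Q = comp P Q + comp P' Q.
Proof. by rewrite -{1}[P]scale1r comp_linl scale1r. Qed.
Lemma compDr P Q Q' : multilinear P -> comp P (Q + Q') = comp P Q + comp P Q'.
Proof. by move=> mP; rewrite -{1}[Q]scale1r comp_linr // scale1r. Qed.
Lemma comp0l Q : comp 0 Q = 0.
Proof. by apply: (addIr (comp 0 Q)); rewrite -compDl !add0r. Qed.
Lemma comp0r P : multilinear P -> comp P 0 = 0.
Proof. by move=> mP; apply: (addIr (comp P 0)); rewrite -compDr // !add0r. Qed.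
Lemma compZl k P Q : comp (k *: P) Q = k *: comp P Q.
Proof. by rewrite -[k *: P]addr0 comp_linl comp0l !addr0. Qed.
Lemma compZr k P Q : multilinear P -> comp P (k *: Q) = k *: comp P Q.
Proof. by move=> mP; rewrite -[k *: Q]addr0 comp_linr // comp0r // !addr0. Qed.

Lemma multilinear_comp P Q : multilinear P -> multilinear Q ->
  multilinear (comp P Q).
Proof.
move=> mP mQ; split=> [s1 s2 k x x' y z|s1 s2 k x y y' z|s k z z'].
- elim: s1 P Q mP mQ => [|X s1 IHs] P Q mP mQ /=.
    have insE (R : C) : multilinear R ->
        ins (k *: x + x', y) R = k *: ins (x, y) R + ins (x', y) R.
      move=> mR; apply/funext => s; apply/funext => v.
      exact: (multilinear_fst mR [::]).
    rewrite !insE // comp_linl comp_linr //.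
    rewrite !fun2E.
    rewrite !dins_app /=.
    rewrite (multilinear_last mQ) !(multilinear_fst mP [::]).
    by lmod K W.
  rewrite !IHs; try by [apply: multilinear_ins|apply: multilinear_alt|].
  rewrite !dins_app -!cat_cons.
  by rewrite !(multilinear_fst mP); lmod K W.
- elim: s1 P Q mP mQ => [|X s1 IHs] P Q mP mQ /=.
    have insE (R : C) : multilinear R ->
        ins (x, k *: y + y') R = k *: ins (x, y) R + ins (x, y') R.
      move=> mR; apply/funext => s; apply/funext => v.
      exact: (multilinear_snd mR [::]).
    rewrite !insE // comp_linl comp_linr //.
    rewrite !fun2E.
    rewrite !dins_app /=.
    rewrite (multilinear_last mQ) !(multilinear_snd mP [::]).
    by lmod K W.
  rewrite !IHs; try by [apply: multilinear_ins|apply: multilinear_alt|].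
  rewrite !dins_app -!cat_cons.
  by rewrite !(multilinear_snd mP); lmod K W.
- elim: s P Q mP mQ => [|X s IHs] P Q mP mQ /=.
    by rewrite (multilinear_last mQ) (multilinear_last mP).
  rewrite !IHs; try by [apply: multilinear_ins|apply: multilinear_alt|].
  rewrite !dins_app.
  by rewrite !(multilinear_last mP); lmod K W.
Qed.

Lemma cochain_ins d X P : cochain d P -> cochain (d - 1) (ins X P).
Proof.
move=> [mP hP]; split=> [|s z sz]; first exact: multilinear_ins.
by apply: hP; rewrite /= -addn1 PoszD; apply: contra sz => /eqP <-;
   rewrite addrK.
Qed.

Lemma cochain_nil d P z : cochain d P -> d != 0 -> P [::] z = 0.
Proof. by move=> [_ hP] d0; apply: hP; rewrite eq_sym. Qed.

Lemma altE d P : cochain d P -> alt P = (-1) ^ d *: P.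
Proof.
move=> [_ hP]; apply/funext => s; apply/funext => z.
rewrite fun2E /alt.
by have [<-//|/hP->] := eqVneq (size s)%:Z d; rewrite !scaler0.
Qed.

Lemma dins_nil d X P Q : multilinear P -> cochain d Q -> d != 0 ->
  dins (Q [::]) X P = 0.
Proof.
move=> mP hQ d0; rewrite -(dins0 X mP); congr (dins _ X P).
by apply/funext => z; rewrite (cochain_nil _ hQ).
Qed.

Lemma cochain_comp d e P Q : cochain d P -> cochain e Q ->
  cochain (d + e) (comp P Q).
Proof.
move=> hP hQ; split; first exact: multilinear_comp hP.1 hQ.1.
move=> s z; elim: s d e P Q hP hQ => [|X s IHs] d e P Q hP hQ /=.
  have [->|e0] := eqVneq e 0.
    by rewrite addr0 eq_sym => /(cochain_nil _ hP)->.
  by rewrite (cochain_nil _ hQ) // multilinear_last0 //; case: hP.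
move=> sz; rewrite (altE hQ) compZr; last exact: (cochain_ins X hP).1.
rewrite fun2E.
rewrite (IHs _ _ _ _ (cochain_ins X hP) hQ); last by lia.
rewrite (IHs _ _ _ _ hP (cochain_ins X hQ)); last by lia.
rewrite scaler0 !add0r; have [e0|e0] := eqVneq e 0; last first.
  by rewrite (dins_nil _ hP.1 hQ).
move: sz; rewrite e0 addr0 => sz.
by rewrite dins_app !hP.2 ?addr0.
Qed.

Lemma comp_cons e P Q X s z : multilinear P -> cochain e Q ->
  comp P Q (X :: s) z = (-1) ^ e *: comp (ins X P) Q s z
    + comp P (ins X Q) s z + dins (Q [::]) X P s z.
Proof.
move=> mP hQ; rewrite /comp -/comp (altE hQ) compZr //.
exact: multilinear_ins.
Qed.

Lemma ins_comp e P Q X : multilinear P -> cochain e Q ->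
  ins X (comp P Q) = (-1) ^ e *: comp (ins X P) Q
    + comp P (ins X Q) + dins (Q [::]) X P.
Proof.
move=> mP hQ; apply/funext => s; apply/funext => z.
by rewrite !fun2E; apply: comp_cons.
Qed.

(** * The pre-Lie identity and the graded Jacobi identity *)

Definition assoc P Q R : C := comp (comp P Q) R - comp P (comp Q R).

(** The terms in which [Q] and [R] act one after the other on the same entry of [X], or in which [R]
    acts on an entry of a pair given to [Q], cancel in the associator. What remains besides the
    three recursive terms is symmetric in [Q] and [R]. *)
Lemma assoc_cons X P Q R q r s z :
  multilinear P -> cochain q Q -> cochain r R ->
  assoc P Q R (X :: s) z =
  ((-1) ^ q * (-1) ^ r) *: assoc (ins X P) Q R s z
  + (-1) ^ r *: assoc P (ins X Q) R s z + assoc P Q (ins X R) s z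
  + ((-1) ^ r *: comp (dins (Q [::]) X P) R s z
     + (-1) ^ q *: comp (dins (R [::]) X P) Q s z
     + (P ((Q [::] X.1, R [::] X.2) :: s) z
        + P ((R [::] X.1, Q [::] X.2) :: s) z)).
Proof.
move=> mP hQ hR; have mQ := hQ.1; have mR := hR.1.
have mXP Y := multilinear_ins Y mP; have mXQ := multilinear_ins X mQ.
have mPQ := multilinear_comp mP mQ.
rewrite /assoc !fun2E (comp_cons _ _ _ mPQ hR).
rewrite (comp_cons _ _ _ mP (cochain_comp hQ hR)) expN1D.
rewrite (ins_comp _ mP hQ) (ins_comp _ mQ hR) !compDl compZl.
rewrite !compDr // compZr //.
rewrite dins_app -![comp P Q (_ :: _) _]/(ins _ (comp P Q) s z).
rewrite !(ins_comp _ mP hQ) !fun2E.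
rewrite !dins_app /=.
by lmod K W.
Qed.

Lemma sign_0 (q r : int) : (q == 0) || (r == 0) -> (-1) ^ (q * r) = 1 :> K.
Proof. by case/orP=> /eqP->; rewrite ?mul0r ?mulr0. Qed.

(** Sign identities are later proved by splitting each power of -1 into its two values and comparing
    coefficients. *)
Lemma expN1_case (q : int) : (-1) ^ q = 1 :> K \/ (-1) ^ q = -1 :> K.
Proof.
have [n [->|->]] : exists n : nat, q = n \/ q = - n%:Z.
- by case: q => n; [exists n; left|exists n.+1; right].
- by rewrite -exprnP -signr_odd; case: odd; [right|left].
- rewrite -exprnN -signr_odd; case: odd; [right|left]; last by rewrite invr1.
  by rewrite expr1 invrN1.
Qed.

Lemma expN1N (q : int) : (-1) ^ (- q) = (-1) ^ q :> K.
Proof.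
have : (-1) ^ (- q) * (-1) ^ q = 1 :> K by rewrite -expN1D addNr.
case: (expN1_case q) => ->; rewrite ?mulr1 // mulrN1 => eq1.
by rewrite -[LHS]opprK eq1.
Qed.

Lemma assoc_sym P Q R q r : multilinear P -> cochain q Q -> cochain r R ->
  assoc P Q R = (-1) ^ (q * r) *: assoc P R Q.
Proof.
move=> mP hQ hR; apply/funext => s; apply/funext => z; rewrite fun2E.
elim: s P Q R q r mP hQ hR => [|X s IHs] P Q R q r mP hQ hR.
  have [qr|] := boolP ((q == 0) || (r == 0)).
    by rewrite sign_0 // scale1r /assoc !fun2E /= !subrr.
  by rewrite negb_or => /andP[q0 r0]; rewrite /assoc !fun2E /= !subrr scaler0.
have mXP := multilinear_ins X mP.
rewrite !(assoc_cons _ _ _ mP hQ hR) !(assoc_cons _ _ _ mP hR hQ).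
rewrite (IHs _ _ _ _ _ mXP hQ hR) (IHs _ _ _ _ _ mP (cochain_ins X hQ) hR).
rewrite (IHs _ _ _ _ _ mP hQ (cochain_ins X hR)).
have -> : (-1) ^ ((q - 1) * r) = (-1) ^ (q * r) * (-1) ^ r :> K.
  by rewrite mulrBl mul1r expN1D expN1N.
have -> : (-1) ^ (q * (r - 1)) = (-1) ^ (q * r) * (-1) ^ q :> K.
  by rewrite mulrBr mulr1 expN1D expN1N.
(* If [q] or [r] is 0, the sign is 1 and the symmetric remainder matches itself; otherwise [Q [::]]
   and [R [::]] are both zero and the remainder disappears. *)
have [qr|] := boolP ((q == 0) || (r == 0)).
  rewrite sign_0 //.
  by case: (expN1_case q) => ->; case: (expN1_case r) => ->; lmod K W.
rewrite negb_or => /andP[q0 r0].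
rewrite !(dins_nil _ mP hQ q0) !(dins_nil _ mP hR r0) !comp0l.
rewrite !(cochain_nil _ hQ q0) !(multilinear_fst0 [::]) //.
rewrite !fun2E.
have -> : P ((R [::] X.1, 0) :: s) z = 0 by apply: (multilinear_snd0 [::]).
by case: (expN1_case q) => ->; case: (expN1_case r) => ->; lmod K W.
Qed.

Definition gbracket (d e : int) P Q : C :=
  comp P Q - (-1) ^ (d * e) *: comp Q P.

(** Each left-nested product is a right-nested one plus an associator; [assoc_sym] leaves three
    associators, and the identity becomes linear in nine atoms. *)
Lemma gbracket_jacobi d e f P Q R :
  cochain d P -> cochain e Q -> cochain f R ->
  gbracket (d + e) f (gbracket d e P Q) R =
  gbracket d (e + f) P (gbracket e f Q R)
  + (-1) ^ (e * f) *: gbracket (d + f) e (gbracket d f P R) Q.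
Proof.
move=> hP hQ hR; have [mP mQ mR] := And3 hP.1 hQ.1 hR.1.
have compE A B D : comp (comp A B) D = comp A (comp B D) + assoc A B D.
  by rewrite addrC subrK.
have compNl A B : comp (- A) B = - comp A B.
  by rewrite -scaleN1r compZl scaleN1r.
have compNr A B : multilinear A -> comp A (- B) = - comp A B.
  by move=> mA; rewrite -scaleN1r compZr // scaleN1r.
rewrite /gbracket !(compDl, compNl, compZl) !compDr // !compNr // !compZr //.
rewrite !compE (assoc_sym mP hQ hR) (assoc_sym mQ hP hR) (assoc_sym mR hP hQ).
rewrite !(mulrDl, mulrDr) !expN1D (mulrC f e).
move: (comp P (comp Q R)) (comp P (comp R Q)) (comp Q (comp P R))
      (comp Q (comp R P)) (comp R (comp P Q)) (comp R (comp Q P))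
      (assoc P R Q) (assoc Q R P) (assoc R Q P) => ? ? ? ? ? ? ? ? ?.
apply/funext => s; apply/funext => z; rewrite !fun2E.
by case: (expN1_case (d * e)) => ->; case: (expN1_case (e * f)) => ->;
   case: (expN1_case (d * f)) => ->; lmod K W.
Qed.

Lemma gbracket_antisym d e P Q :
  gbracket d e P Q = - ((-1) ^ (d * e) *: gbracket e d Q P).
Proof.
apply/funext => s; apply/funext => z; rewrite /gbracket !fun2E (mulrC e d).
by case: (expN1_case (d * e)) => ->; lmod K W.
Qed.

(** * Comparison of the recursive product with the shuffle formula *)

Definition part n P : C := fun s z => if size s == n then P s z else 0.

Lemma multilinear_part n P : multilinear P -> multilinear (part n P).
Proof.
case=> P1 P2 P3; split=> *; rewrite /part ?size_cat /=; case: ifP => _;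
  by rewrite ?P1 ?P2 ?P3 // scaler0 addr0.
Qed.

Lemma cochain_part n P : multilinear P -> cochain n%:Z (part n P).
Proof.
move=> mP; split; first exact: multilinear_part.
by move=> s z; rewrite /part eqz_nat => /negPf->.
Qed.

Lemma part_cochain n d P : cochain d P ->
  part n P = if d == n%:Z then P else 0.
Proof.
move=> [_ hP]; apply/funext => s; apply/funext => z; rewrite /part.
have [sz|sz] := eqVneq (size s) n; have [d_n|d_n] := eqVneq d n%:Z => //.
  by apply: hP; rewrite sz eq_sym.
by rewrite hP // d_n eqz_nat.
Qed.

Definition ush j (F : seq (W * W) -> seq (W * W) -> W) s : W :=
  unshuffle_sum (K := K) (fun=> 1)
    (fun A B => if size A == j then F A B else 0) s.

Lemma ush_nil j F : ush j F [::] = if j is 0 then F [::] [::] else 0.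
Proof. by case: j. Qed.

Lemma eq_ush j F G s :
  (forall A B, size A = j -> (size A + size B)%N = size s -> F A B = G A B) ->
  ush j F s = ush j G s.
Proof.
move=> eqFG; apply: eq_unshuffle_size => A B sz.
by case: eqP => // sz_A; apply: eqFG.
Qed.

Lemma ush_big j F s : (size s < j)%N -> ush j F s = 0.
Proof.
move=> lt_s; rewrite -[RHS](unshuffle0 (fun=> 1) W s).
apply: eq_unshuffle_size => A B sz; case: eqP => // sz_A.
by move: lt_s; rewrite -sz sz_A ltnNge leq_addr.
Qed.

Lemma ush_cons j F X s : ush j F (X :: s) =
  (if j is i.+1 then ush i (fun A B => F (X :: A) B) s else 0)
  + (-1) ^+ j *: ush j (fun A B => F A (X :: B)) s.
Proof.
rewrite /ush /= -unshuffleZ; congr (_ + _).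
  by case: j => [|j] //; apply: unshuffle0.
apply: eq_unshuffle_size => A B _; rewrite degs1 mul1r.
by case: eqP => [->|_]; rewrite ?scaler0.
Qed.

Lemma signed_shuffle_sumE n i (F : seq (W * W) -> seq (W * W) -> W) s :
  (i <= n)%N -> (n <= size s)%N ->
  \sum_(sg : 'S_n | shuffle i sg) ((-1) ^+ sg : K) *:
    F (take i (perm_args sg s)) (drop i (perm_args sg s)) =
  ush i F (take n s).
Proof.
move=> le_in le_n; have -> : take n s = [seq nth 0 s k | k : 'I_n].
  apply: (@eq_from_nth _ 0).
    by rewrite size_takel // size_map size_enum_ord.
  rewrite size_takel // => k lt_k; rewrite nth_take //.
  rewrite (nth_map (Ordinal lt_k)) ?size_enum_ord //=.
  by rewrite nth_enum_ord.
rewrite /ush -(shuffle_sumE (fun=> 1) (fun k : 'I_n => nth 0 s k) F le_in).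
by apply: eq_bigr => sg _; rewrite koszul1.
Qed.

Lemma circ_ushE p q P Q s x : size s = (p + q)%N ->
  circ p q P Q s x =
  \sum_(j < p) (-1) ^+ (j * q) *:
    ush j (fun A B => dins (Q B) (nth 0 s (j + q))
                        (fun u => P (A ++ u)) (drop (j + q).+1 s) x)
      (take (j + q) s)
  + (-1) ^+ (p * q) *: ush p (fun A B => P A (Q B x)) s.
Proof.
move=> sz; rewrite /circ -big_split /=; congr (_ + _).
  apply: eq_bigr => j _; rewrite -scalerDr -big_split /=; congr (_ *: _).
  rewrite -signed_shuffle_sumE ?leq_addr //; last first.
    by rewrite sz leq_add2r ltnW.
  by apply: eq_bigr => sg _; rewrite -scalerDr.
rewrite -{3}[s]take_size sz -signed_shuffle_sumE ?leq_addr ?sz //.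
by rewrite scaler_sumr; apply: eq_bigr => sg _; rewrite scalerA.
Qed.

Lemma sign_eq m n : odd m = odd n -> (-1) ^+ m = (-1) ^+ n :> K.
Proof. by move=> mn; rewrite -signr_odd mn signr_odd. Qed.

Lemma ins_cochain0 X P : cochain 0 P -> ins X P = 0.
Proof.
by move=> [_ hP]; apply/funext => s; apply/funext => z; apply: hP.
Qed.

(** Induction on the list: in each shuffle sum the first pair is the one acted on by [Q], or lies in
    the block of [P], or lies in the block of [Q], which are the three terms of [comp]. *)
Lemma circE p q P Q s x : cochain p%:Z P -> cochain q%:Z Q ->
  size s = (p + q)%N -> circ p q P Q s x = comp P Q s x.
Proof.
move=> hP hQ sz; rewrite circ_ushE //.
elim: s p q P Q hP hQ sz => [|X s IHs] p q P Q hP hQ sz.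
  case: p hP sz => // hP; case: q hQ => // hQ _.
  by rewrite big_ord0 add0r mul0n expr0 scale1r ush_nil.
have mP := hP.1; rewrite (comp_cons _ _ _ mP hQ).
(* For [q = 0] the block of [Q] is empty: the summand [j = 0] is the derivation term on [X], and in
   all the others [X] goes to [P]. *)
case: q hQ sz => [|q] hQ sz.
  case: p hP sz => // p hP [sz]; rewrite (ins_cochain0 X hQ) comp0r // fun20.
  have hXP : cochain p%:Z (ins X P).
    by have := cochain_ins X hP; rewrite -addn1 PoszD addrK.
  rewrite addr0 expr0z scale1r -(IHs _ _ _ _ hXP hQ) // big_ord_recl.
  rewrite addn0 take0 ush_nil expr0 scale1r.
  rewrite !muln0 expr0 !scale1r ush_cons (@ush_big p.+1) ?sz ?addn0 //.
  rewrite scaler0 addr0.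
  rewrite -addrA [LHS]addrC [in RHS]/=; congr (_ + _); last by rewrite /= drop0.
  congr (_ + _); apply: eq_bigr => i _; rewrite !muln0 !addn0 /=.
  rewrite ush_cons (@ush_big i.+1) ?scaler0 ?addr0 //.
  by rewrite add0n size_takel // sz addn0 ltnW.
rewrite (dins_nil _ mP hQ) // addr0.
have hXQ : cochain q%:Z (ins X Q).
  by have := cochain_ins X hQ; rewrite -addn1 PoszD addrK.
case: p hP sz => [|p] hP; rewrite ?addnS => -[sz].
  rewrite (ins_cochain0 X hP) comp0l fun20 scaler0 add0r.
  rewrite -(IHs _ _ _ _ hP hXQ) // !big_ord0 !add0r !mul0n expr0 !scale1r.
  by rewrite ush_cons add0r expr0 scale1r.
have hXP : cochain p%:Z (ins X P).
  by have := cochain_ins X hP; rewrite -addn1 PoszD addrK.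
rewrite -(IHs _ _ _ _ hXP hQ) ?addnS // -(IHs _ _ _ _ hP hXQ) //.
rewrite ush_cons !scalerDr scalerA -exprD addrACA; congr (_ + _); last first.
  congr (_ + _ *: _); first by rewrite scalerA -exprD mulSn.
  by apply: sign_eq; rewrite oddD !oddM /=; case: (odd p); case: (odd q).
rewrite scaler_sumr.
(* [F1] collects the shuffles giving [X] to [P], where the block of [P] loses an element and [j]
   drops by one, leaving the sign [(-1) ^+ q.+1]; [F2] collects those giving [X] to [Q], where the
   [j] pairs passed over turn the exponent [j * q.+1] into [j * q] modulo 2. *)
pose F1 (j : nat) := ush j (fun A B => dins (Q B) (nth 0 s (j + q.+1))
  (fun u => ins X P (A ++ u)) (drop (j + q.+1).+1 s) x) (take (j + q.+1) s).
pose F2 (j : nat) := ush j (fun A B => dins (ins X Q B) (nth 0 s (j + q))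
  (fun u => P (A ++ u)) (drop (j + q).+1 s) x) (take (j + q) s).
transitivity (\sum_(j < p.+1) ((-1) ^+ (j * q.+1) *:
    (if (j : nat) is i.+1 then F1 i else 0) + (-1) ^+ (j * q) *: F2 j)).
  apply: eq_bigr => j _; rewrite addnS /= ush_cons scalerDr scalerA -exprD.
  congr (_ *: _ + _ *: _).
    by case: (nat_of_ord j) => // i; rewrite /F1 !addnS.
  by apply: sign_eq; rewrite oddD !oddM /=; case: (odd j); case: (odd q).
rewrite big_split /=; congr (_ + _); rewrite big_ord_recl /= scaler0 add0r.
by apply: eq_bigr => i _; rewrite scalerA -exprD mulSn.
Qed.

Lemma circ_part p q P Q s x : size s = (p + q)%N ->
  circ p q P Q s x = circ p q (part p P) (part q Q) s x.
Proof.
move=> sz; rewrite !circ_ushE //; congr (_ + _ *: _).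
  apply: eq_bigr => j _; congr (_ *: _); apply: eq_ush => A B sz_A sz_AB.
  have le_s : (j + q <= size s)%N by rewrite sz leq_add2r ltnW.
  have sz_B : size B = q.
    by move: sz_AB; rewrite size_takel // sz_A => /addnI.
  rewrite !dins_app /part sz_B eqxx !size_cat /= size_drop sz_A sz.
  by rewrite (_ : (j + _)%N == p) //; have := ltn_ord j; lia.
apply: eq_ush => A B sz_A sz_AB; have sz_B : size B = q.
  by move: sz_AB; rewrite sz sz_A => /addnI.
by rewrite /part sz_A sz_B !eqxx.
Qed.

Lemma circ_comp p q P Q s x : multilinear P -> multilinear Q ->
  size s = (p + q)%N -> circ p q P Q s x = comp (part p P) (part q Q) s x.
Proof.
by move=> mP mQ sz; rewrite circ_part // circE //; apply: cochain_part.
Qed.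

Lemma bracket_comp P Q s x : multilinear P -> multilinear Q ->
  bracket P Q s x = \sum_(p < (size s).+1)
    gbracket p%:Z (size s - p)%:Z (part p P) (part (size s - p)%N Q) s x.
Proof.
move=> mP mQ; apply: eq_bigr => p _.
have le_p : (p <= size s)%N by rewrite -ltnS.
by rewrite /gbracket !fun2E !circ_comp // ?subnK ?subnKC.
Qed.

Lemma part_lin n k P P' : part n (k *: P + P') = k *: part n P + part n P'.
Proof.
apply/funext => s; apply/funext => z; rewrite !fun2E /part.
by case: ifP; rewrite ?fun2E // scaler0 addr0.
Qed.

Lemma multilinear_gbracket d e P Q : multilinear P -> multilinear Q ->
  multilinear (gbracket d e P Q).
Proof.
move=> mP mQ; rewrite /gbracket addrC -scaleNr; apply: multilinear_lin.
  exact: multilinear_comp.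
exact: multilinear_comp.
Qed.

(** Homogeneity is not assumed, because the operations must be multilinear on the whole direct
    sum. *)
Lemma multilinear_bracket P Q : multilinear P -> multilinear Q ->
  multilinear (bracket P Q).
Proof.
move=> mP mQ; have mB (p n : nat) :
  multilinear (gbracket p n (part p P) (part n Q)).
  by apply: multilinear_gbracket; apply: multilinear_part.
split=> *; rewrite !bracket_comp // ?size_cat /= ?scaler_sumr -?big_split /=;
  apply: eq_bigr => p _.
- exact: (multilinear_fst (mB _ _)).
- exact: (multilinear_snd (mB _ _)).
- exact: (multilinear_last (mB _ _)).
Qed.

Lemma gbracket_linl d e k P P' Q : multilinear Q ->
  gbracket d e (k *: P + P') Q = k *: gbracket d e P Q + gbracket d e P' Q.
Proof.
move=> mQ; rewrite /gbracket comp_linl comp_linr //.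
apply/funext => s; apply/funext => z; rewrite !fun2E.
by lmod K W.
Qed.

Lemma gbracket_linr d e k P Q Q' : multilinear P ->
  gbracket d e P (k *: Q + Q') = k *: gbracket d e P Q + gbracket d e P Q'.
Proof.
move=> mP; rewrite /gbracket comp_linl comp_linr //.
apply/funext => s; apply/funext => z; rewrite !fun2E.
by lmod K W.
Qed.

Lemma bracket_linl k P P' Q : multilinear P -> multilinear P' ->
  multilinear Q ->
  bracket (k *: P + P') Q = k *: bracket P Q + bracket P' Q.
Proof.
move=> mP mP' mQ; apply/funext => s; apply/funext => z; rewrite !fun2E.
rewrite !bracket_comp //; last exact: multilinear_lin.
rewrite scaler_sumr -big_split /=; apply: eq_bigr => p _.
by rewrite part_lin gbracket_linl //; apply: multilinear_part.
Qed.

Lemma bracket_linr k P Q Q' : multilinear P -> multilinear Q ->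
  multilinear Q' ->
  bracket P (k *: Q + Q') = k *: bracket P Q + bracket P Q'.
Proof.
move=> mP mQ mQ'; apply/funext => s; apply/funext => z; rewrite !fun2E.
rewrite !bracket_comp //; last exact: multilinear_lin.
rewrite scaler_sumr -big_split /=; apply: eq_bigr => p _.
by rewrite part_lin gbracket_linr //; apply: multilinear_part.
Qed.

Lemma cochain_gbracket d e P Q : cochain d P -> cochain e Q ->
  cochain (d + e) (gbracket d e P Q).
Proof.
move=> hP hQ; split; first by apply: multilinear_gbracket; [case: hP|case: hQ].
move=> s z sz; rewrite /gbracket !fun2E (cochain_comp hP hQ).2 //.
by rewrite (cochain_comp hQ hP).2 ?scaler0 ?subr0 // addrC.
Qed.

Lemma bracketE d e P Q : cochain d P -> cochain e Q ->
  bracket P Q = gbracket d e P Q.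
Proof.
move=> hP hQ; have [mP mQ] := conj hP.1 hQ.1.
apply/funext => s; apply/funext => z; rewrite bracket_comp //.
have gb0l d' e' (R : C) : multilinear R -> gbracket d' e' 0 R = 0.
  by move=> mR; rewrite /gbracket comp0l comp0r // scaler0 subr0.
have gb0r d' e' (R : C) : multilinear R -> gbracket d' e' R 0 = 0.
  by move=> mR; rewrite /gbracket comp0l comp0r // scaler0 subr0.
have [sz|sz] := eqVneq (size s)%:Z (d + e); last first.
  rewrite (cochain_gbracket hP hQ).2 // big1 // => p _.
  have le_p : (p <= size s)%N by rewrite -ltnS.
  rewrite (part_cochain _ hP) (part_cochain _ hQ).
  case: eqP => [d_p|_]; last first.
    by rewrite gb0l //; case: ifP => _ //; apply: multilinear0.
  by case: eqP => [e_p|_]; [move: sz; lia|rewrite gb0r].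
have part0 n : part n 0 = 0.
  by apply/funext => t; apply/funext => v; rewrite /part; case: ifP.
(* Degrees are integers while [bracket] sums over natural numbers; in negative degree both sides
   vanish. *)
have neg0 (R : C) n : cochain (Negz n) R -> R = 0.
  by move=> [_ hR]; apply/funext => t; apply/funext => v; apply: hR.
case: d hP sz => [p|p] hP sz; last first.
  rewrite (neg0 _ _ hP) gb0l // big1 // => i _.
  by rewrite part0 gb0l //; apply: multilinear_part.
case: e hQ sz => [q|q] hQ sz; last first.
  rewrite (neg0 _ _ hQ) gb0r // big1 // => i _.
  by rewrite part0 gb0r //; apply: multilinear_part.
have {}sz : size s = (p + q)%N by move: sz; lia.
have lt_p : (p < (size s).+1)%N by rewrite ltnS sz leq_addr.
rewrite (bigD1 (Ordinal lt_p)) //= big1 ?addr0 => [|i i_p].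
  by rewrite sz addKn (part_cochain _ hP) (part_cochain _ hQ) !eqxx.
rewrite (part_cochain _ hP) eqz_nat eq_sym.
have -> : (nat_of_ord i == p) = false.
  by apply: contraNF i_p => /eqP i_p; apply/eqP/val_inj.
by rewrite gb0l //; apply: multilinear_part.
Qed.
End Composition.

(** * Further rules for unshuffle sums *)

Section UnshuffleTheory.
Variables (K : fieldType) (X : eqType) (deg : X -> int) (E : lmodType K).
Implicit Types (F G : seq X -> seq X -> E) (s : seq X).

Lemma eq_unshuffle F G s :
  (forall A B, perm_eq (A ++ B) s -> F A B = G A B) ->
  unshuffle_sum deg F s = unshuffle_sum deg G s.
Proof.
elim: s F G => [|x s IHs] F G eqFG /=; first exact: eqFG.
congr (_ + _); apply: IHs => A B AB; first by apply: eqFG; rewrite /= perm_cons.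
rewrite eqFG //; apply: (perm_trans (y := x :: A ++ B)); last first.
  by rewrite perm_cons.
by rewrite -cat1s perm_catCA.
Qed.

Lemma unshuffleD F G s :
  unshuffle_sum deg (fun A B => F A B + G A B) s =
  unshuffle_sum deg F s + unshuffle_sum deg G s.
Proof.
elim: s F G => [|x s IHs] F G //=.
rewrite addrACA; congr (_ + _); rewrite -IHs //.
by apply: eq_unshuffle => A B _; rewrite scalerDr.
Qed.

Lemma unshuffle_bigsum (I : Type) (r : seq I) (F : I -> seq X -> seq X -> E) s :
  unshuffle_sum deg (fun A B => \sum_(i <- r) F i A B) s =
  \sum_(i <- r) unshuffle_sum deg (F i) s.
Proof.
elim: r => [|i r IHr].
  rewrite big_nil -[RHS](unshuffle0 deg E s).
  by apply: eq_unshuffle => A B _; rewrite big_nil.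
rewrite big_cons -IHr -unshuffleD.
by apply: eq_unshuffle => A B _; rewrite big_cons.
Qed.

(** The Koszul sign is that of moving the block [A] past the block [B]; the induction exchanges the
    two branches of the recursion. *)
Lemma unshuffle_swap F s :
  unshuffle_sum deg F s =
  unshuffle_sum deg (fun A B => (-1) ^ (degs deg A * degs deg B) *: F B A) s.
Proof.
elim: s F => [|x s IHs] F /=.
  by rewrite /degs !big_nil mul0r expr0z scale1r.
rewrite addrC [X in X + _]IHs [X in _ + X]IHs; congr (_ + _).
  apply: eq_unshuffle => A B _; rewrite scalerA -expN1D degs_cons.
  by congr (_ ^ _ *: _); ring.
apply: eq_unshuffle => A B _; rewrite scalerA -expN1D degs_cons; congr (_ *: _).
rewrite mulrDr (mulrC _ (deg x)) !expN1D.
by case: (expN1_case K (deg x * degs deg A)) => ->;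
   rewrite ?mul1r ?mulN1r ?opprK.
Qed.
End UnshuffleTheory.

Section UnshuffleMap.
Variables (K : fieldType) (X : eqType) (deg : X -> int) (E E' : lmodType K).

Lemma unshuffle_map (f : E -> E') F s :
  (forall (k : K) x y, f (k *: x + y) = k *: f x + f y) ->
  f (unshuffle_sum deg F s) = unshuffle_sum deg (fun A B => f (F A B)) s.
Proof.
move=> fL; have fD x y : f (x + y) = f x + f y.
  by have := fL 1 x y; rewrite !scale1r.
have f0 : f 0 = 0 by apply: (addIr (f 0)); rewrite -fD !add0r.
have fZ (k : K) x : f (k *: x) = k *: f x by rewrite -[k *: x]addr0 fL f0 addr0.
elim: s F => //= x s IHs F; rewrite fD !IHs; congr (_ + _).
by apply: eq_unshuffle => A B _; rewrite fZ.
Qed.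
End UnshuffleMap.

(** * Higher derived brackets *)

(** The Jacobi identity is stated as a derivation rule for [lie - z], the form that is iterated
    along lists. Degrees are passed as witnesses, since 0 lies in every [H d]. *)
Record graded_lie (K : fieldType) (E : lmodType K) (H : int -> set E)
    (lie : E -> E -> E) : Prop := GradedLie {
  glie_hom0 : forall d, H d 0;
  glie_hom_lin : forall d (k : K) x y, H d x -> H d y -> H d (k *: x + y);
  glie_hom : forall d e x y, H d x -> H e y -> H (d + e) (lie x y);
  glie_linl : forall d e (k : K) x x' y, H d x -> H d x' -> H e y ->
    lie (k *: x + x') y = k *: lie x y + lie x' y;
  glie_linr : forall d e (k : K) x y y', H d x -> H e y -> H e y' ->
    lie x (k *: y + y') = k *: lie x y + lie x y';
  glie_antisym : forall d e x y, H d x -> H e y ->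
    lie x y = - ((-1) ^ (d * e) *: lie y x);
  glie_jacobi : forall d e f x y z, H d x -> H e y -> H f z ->
    lie (lie x y) z = lie x (lie y z) + (-1) ^ (e * f) *: lie (lie x z) y }.

(* Voronov's construction: [emb] embeds [F] as an abelian subalgebra, and the
   kernel of the retraction [pr] is a subalgebra containing [Om]. *)
Section HigherDerivedBrackets.
Variables (K : fieldType) (E F : lmodType K) (H : int -> set E)
  (HF : int -> set F) (lie : E -> E -> E) (emb : F -> E) (pr : E -> F) (Om : E).
Hypothesis glie : graded_lie H lie.
Hypothesis emb_lin : forall (k : K) x y, emb (k *: x + y) = k *: emb x + emb y.
Hypothesis pr_lin : forall (k : K) x y, pr (k *: x + y) = k *: pr x + pr y.
Hypothesis emb_hom : forall d x, HF d x -> H d (emb x).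
Hypothesis pr_hom : forall d x, H d x -> HF d (pr x).
Hypothesis embK : forall x, pr (emb x) = x.
Hypothesis emb_abelian : forall d e x y, HF d x -> HF e y ->
  lie (emb x) (emb y) = 0.
Hypothesis pr_ker : forall d e x y, H d x -> H e y -> pr x = 0 -> pr y = 0 ->
  pr (lie x y) = 0.

Lemma lie0l e y : H e y -> lie 0 y = 0.
Proof.
move=> hy; have h0 := glie_hom0 glie 0.
by have := glie_linl glie (-1) h0 h0 hy; rewrite !scaleN1r !addNr.
Qed.

Lemma lie0r e y : H e y -> lie y 0 = 0.
Proof.
move=> hy; have h0 := glie_hom0 glie 0.
by have := glie_linr glie (-1) hy h0 h0; rewrite !scaleN1r !addNr.
Qed.

Lemma pr0 : pr 0 = 0.
Proof. by have := pr_lin (-1) 0 0; rewrite !scaleN1r !addNr. Qed.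

Lemma emb0 : emb 0 = 0.
Proof. by have := emb_lin (-1) 0 0; rewrite !scaleN1r !addNr. Qed.

Lemma prZ k x : pr (k *: x) = k *: pr x.
Proof. by rewrite -[k *: x]addr0 pr_lin pr0 addr0. Qed.

(* Elements come paired with a degree, which is not determined for 0. *)
Definition ad (a : E) (ps : seq (int * F)) : E :=
  foldl (fun b p => lie b (emb p.2)) a ps.

Notation hom_seq ps := (forall p, p \in ps -> HF p.1 p.2).

Lemma hom_seq_cons p ps :
  hom_seq (p :: ps) -> HF p.1 p.2 /\ hom_seq ps.
Proof.
move=> h; split; first by apply: h; rewrite mem_head.
by move=> q qs; apply: h; rewrite in_cons qs orbT.
Qed.

Lemma hom_seq_perm A B ps : perm_eq (A ++ B) ps -> hom_seq ps ->
  hom_seq A /\ hom_seq B.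
Proof.
move=> /perm_mem AB h.
by split=> p pA; apply: h; rewrite -AB mem_cat pA ?orbT.
Qed.

Lemma ad_hom d a ps : H d a -> hom_seq ps -> H (d + degs fst ps) (ad a ps).
Proof.
elim: ps d a => [|p ps IHps] d a ha; first by rewrite /degs big_nil addr0.
move=> /hom_seq_cons[hp hps]; rewrite degs_cons addrA.
by apply: IHps => //; apply: (glie_hom glie) => //; apply: emb_hom.
Qed.

Lemma ad_lin d k a a' ps : H d a -> H d a' -> hom_seq ps ->
  ad (k *: a + a') ps = k *: ad a ps + ad a' ps.
Proof.
elim: ps d a a' => //= p ps IHps d a a' ha ha' /hom_seq_cons[hp hps].
have hep := emb_hom hp.
rewrite (glie_linl glie _ ha ha' hep).
by rewrite (IHps _ _ _ (glie_hom glie ha hep) (glie_hom glie ha' hep)).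
Qed.

Lemma ad0 ps : hom_seq ps -> ad 0 ps = 0.
Proof.
move=> hps; have h0 := glie_hom0 glie 0.
by have := ad_lin (-1) h0 h0 hps; rewrite !scaleN1r !addNr.
Qed.

Lemma adZ d k a ps : H d a -> hom_seq ps -> ad (k *: a) ps = k *: ad a ps.
Proof.
move=> ha hps; have := ad_lin k ha (glie_hom0 glie d) hps.
by rewrite ad0 // !addr0.
Qed.

(* [[-, x]] is a graded derivation, hence its iterates satisfy a Leibniz rule
   over unshuffles. *)
Lemma ad_lie d e a b ps : H d a -> H e b -> hom_seq ps ->
  ad (lie a b) ps =
  unshuffle_sum fst
    (fun A B => (-1) ^ (e * degs fst A) *: lie (ad a A) (ad b B)) ps.
Proof.
elim: ps d e a b => [|p ps IHps] d e a b ha hb hps.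
  by rewrite /= /degs big_nil mulr0 expr0z scale1r.
have [hp {}hps] := hom_seq_cons hps; have hep := emb_hom hp.
have hap := glie_hom glie ha hep; have hbp := glie_hom glie hb hep.
rewrite [LHS]/= (glie_jacobi glie ha hb hep) addrC.
have hab := glie_hom glie hap hb.
rewrite (ad_lin _ hab) //; last first.
  by rewrite addrAC -addrA; apply: (glie_hom glie).
rewrite (IHps _ _ _ _ hap hb hps) (IHps _ _ _ _ ha hbp hps) /=.
congr (_ + _).
  rewrite -unshuffleZ; apply: eq_unshuffle => A B _.
  by rewrite scalerA -expN1D degs_cons mulrDr.
apply: eq_unshuffle => A B _.
by rewrite scalerA -expN1D mulrDl addrC.
Qed.

(** The derivations given by embedded elements kill [emb x], as [emb] has abelian image, so they all
    act on [b]. *)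
Lemma ad_lie_emb d e x b ps : HF d x -> H e b -> hom_seq ps ->
  ad (lie (emb x) b) ps = lie (emb x) (ad b ps).
Proof.
elim: ps e b => //= p ps IHps e b hx hb /hom_seq_cons[hp hps].
have [hex hep] := conj (emb_hom hx) (emb_hom hp).
rewrite (glie_jacobi glie hex hb hep) (emb_abelian hx hp) (lie0l hb) scaler0.
by rewrite addr0 (IHps _ _ hx (glie_hom glie hb hep)).
Qed.

(* Split [a] and [b] along [E = emb F + ker pr]: the bracket of the two
   [emb]-parts vanishes, and that of the two kernel parts is killed by [pr]. *)
Lemma pr_lie d e a b : H d a -> H e b ->
  pr (lie a b) = pr (lie (emb (pr a)) b) + pr (lie a (emb (pr b))).
Proof.
move=> ha hb; pose ka := -1 *: emb (pr a) + a; pose kb := -1 *: emb (pr b) + b.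
have hea := emb_hom (pr_hom ha); have heb := emb_hom (pr_hom hb).
have hka : H d ka by apply: (glie_hom_lin glie).
have hkb : H e kb by apply: (glie_hom_lin glie).
have pka : pr ka = 0 by rewrite /ka pr_lin embK scaleN1r addNr.
have pkb : pr kb = 0 by rewrite /kb pr_lin embK scaleN1r addNr.
have := pr_ker hka hkb pka pkb; rewrite /ka (glie_linl glie _ hea ha hkb) /kb.
rewrite (glie_linr glie _ hea heb hb) (glie_linr glie _ ha heb hb).
rewrite (emb_abelian (pr_hom ha) (pr_hom hb)) !pr_lin pr0 => /eqP.
rewrite scaler0 add0r !scaleN1r addrA addrC -opprD subr_eq0 => /eqP ->.
by [].
Qed.

Hypothesis Om_hom : H 1 Om.
Hypothesis Om_pr : pr Om = 0.
Hypothesis Om_square : lie Om Om = 0.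
Hypothesis char2 : (2 : K) != 0.

Definition derived_op (xs : seq F) : F :=
  pr (foldl (fun b x => lie b (emb x)) Om xs).

Lemma derivedE ps : derived_op (map snd ps) = pr (ad Om ps).
Proof.
by rewrite /derived_op /ad; elim: ps Om => //= p ps IHps a.
Qed.

Lemma derived_hom ps :
  hom_seq ps -> HF (1 + degs fst ps) (derived_op (map snd ps)).
Proof. by move=> hps; rewrite derivedE; apply: pr_hom; apply: ad_hom. Qed.

(* Expanding [0 = pr [..[[Om, Om], x1].., xn]] over unshuffles, the two summands
   given by [pr_lie] contribute the same Jacobiator, whence [char2]. *)
Lemma derived_unshuffle ps : hom_seq ps ->
  unshuffle_sum fst
    (fun A B => derived_op (derived_op (map snd A) :: map snd B)) ps = 0.
Proof.
move=> hps.
pose L (A B : seq (int * F)) :=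
  pr (lie (emb (derived_op (map snd A))) (ad Om B)).
(* The inner value has degree [1 + degs fst A] and [Om] has degree 1, so moving the inner value to
   the left of [Om] costs [- (-1) ^ (1 + degs fst A)]. *)
transitivity (unshuffle_sum fst (fun A B => (-1) ^ degs fst A *: L A B) ps).
  apply: eq_unshuffle => A B AB; have [hA hB] := hom_seq_perm AB hps.
  have hy := derived_hom hA; have hey := emb_hom hy.
  rewrite -[_ :: _]/(map snd ((1 + degs fst A, derived_op (map snd A)) :: B)).
  rewrite derivedE /= (glie_antisym glie Om_hom hey) -scaleNr.
  rewrite (adZ _ (glie_hom glie hey Om_hom)) // (ad_lie_emb hy Om_hom) //.
  rewrite prZ /L; congr (_ *: _).
  by rewrite mul1r expN1D expr1z mulN1r opprK.
set S := unshuffle_sum _ _ _.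
have : pr (ad (lie Om Om) ps) = S + S.
  rewrite (ad_lie Om_hom Om_hom hps) (unshuffle_map fst _ _ pr_lin).
  (* The second summand of [pr_lie] projects the block [B] instead of [A], so the blocks are
     exchanged in one copy of [S] before comparing term by term. *)
  rewrite {2}/S [X in _ = _ + X]unshuffle_swap -unshuffleD.
  apply: eq_unshuffle => A B AB.
  have [hA hB] := hom_seq_perm AB hps.
  have haA := ad_hom Om_hom hA; have haB := ad_hom Om_hom hB.
  rewrite prZ mul1r (pr_lie haA haB) -!derivedE scalerDr; congr (_ + _).
  rewrite (glie_antisym glie haA (emb_hom (derived_hom hB))) -scaleNr prZ /L.
  rewrite !scalerA; congr (_ *: _).
  rewrite mulrDl mulrDr !mulrDr !mul1r !mulr1 !expN1D expr1z.
  by case: (expN1_case K (degs fst A)) => ->;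
     case: (expN1_case K (degs fst B)) => ->; ring.
rewrite Om_square ad0 // pr0 => /eqP; rewrite eq_sym -mulr2n -scaler_nat.
by rewrite scaler_eq0 (negPf char2) => /eqP.
Qed.

(** Since embedded elements have zero bracket, the Jacobi identity makes the operators [[-, emb p]]
    commute up to the Koszul sign. This gives the graded symmetry of the derived brackets. *)
Lemma ad_move a d p A B : H d a -> HF p.1 p.2 -> hom_seq A -> hom_seq B ->
  ad a (A ++ p :: B) = (-1) ^ (p.1 * degs fst A) *: ad a (p :: A ++ B).
Proof.
move=> ha hp hA hB; elim: A d a ha hA => [|q A IHA] d a ha hA.
  by rewrite /degs big_nil mulr0 expr0z scale1r.
have [hq {}hA] := hom_seq_cons hA.
have [hep heq] := conj (emb_hom hp) (emb_hom hq).
have haq := glie_hom glie ha heq.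
have hAB : hom_seq (A ++ B) by move=> r; rewrite mem_cat => /orP[/hA|/hB].
rewrite /= (IHA _ _ haq) // /= (glie_jacobi glie ha heq hep).
rewrite (emb_abelian hq hp) (lie0r ha) add0r.
rewrite (adZ _ (glie_hom glie (glie_hom glie ha hep) heq)) // scalerA -expN1D.
by rewrite degs_cons mulrDr addrC [p.1 * q.1]mulrC.
Qed.

Lemma ad_permuted a d n (s : 'S_n) (p : 'I_n -> int * F) :
  H d a -> (forall i, HF (p i).1 (p i).2) ->
  ad a (permuted s p) =
  koszul K (fst \o p) s *: ad a [seq p i | i <- enum 'I_n].
Proof.
elim: n s p d a => [|n IHn] s p d a ha hp.
  by rewrite /permuted enum_ord0 /koszul big_ord0 scale1r.
have hperm (t : 'S_n) : hom_seq (permuted t (p \o lift ord0)).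
  by move=> q /mapP[i _ ->]; apply: hp.
have [j [t ->]] := lift_perm_ord0P s.
rewrite permuted_lift koszul_lift_degs enum_ordSl /=.
have hpt := hperm t; rewrite -[permuted t _](cat_take_drop j) in hpt.
have [hA hB] : hom_seq (take j (permuted t (p \o lift ord0))) /\
               hom_seq (drop j (permuted t (p \o lift ord0))).
  by split=> q qs; apply: hpt; rewrite mem_cat qs ?orbT.
rewrite (ad_move ha) // cat_take_drop /= -map_comp.
have hap := glie_hom glie ha (emb_hom (hp ord0)).
rewrite (IHn _ _ _ _ hap) => [|i]; last exact: hp.
by rewrite scalerA.
Qed.

Lemma map_permuted (X Y : Type) (f : X -> Y) n (s : 'S_n) (x : 'I_n -> X) :
  map f (permuted s x) = permuted s (f \o x).
Proof. by rewrite /permuted -map_comp. Qed.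

Lemma derived_symmetric n (d : 'I_n -> int) (x : 'I_n -> F) (s : 'S_n) :
  (forall i, HF (d i) (x i)) ->
  derived_op (permuted s x) =
  koszul K d s *: derived_op [seq x i | i <- enum 'I_n].
Proof.
move=> hx; pose p i := (d i, x i).
have -> : [seq x i | i <- enum 'I_n] = map snd [seq p i | i <- enum 'I_n].
  by rewrite -map_comp.
rewrite -[permuted s x](map_permuted snd s p).
by rewrite !derivedE (ad_permuted _ Om_hom) // prZ.
Qed.

Lemma derived_jacobi n (d : 'I_n -> int) (x : 'I_n -> F) :
  (forall i, HF (d i) (x i)) ->
  \sum_(1 <= i < n.+1) \sum_(s : 'S_n | shuffle i s)
    koszul K d s *:
      derived_op (derived_op (take i (permuted s x)) :: drop i (permuted s x))
  = 0.
Proof.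
move=> hx; pose p i := (d i, x i).
pose G (A B : seq (int * F)) :=
  derived_op (derived_op (map snd A) :: map snd B : seq F).
transitivity (\sum_(1 <= i < n.+1) unshuffle_sum fst
   (fun A B => if size A == i then G A B else 0) [seq p k | k <- enum 'I_n]).
  rewrite big_nat [RHS]big_nat; apply: eq_bigr => i /andP[_ lt_i].
  rewrite -shuffle_sumE //; apply: eq_bigr => s _.
  by rewrite /G map_take map_drop map_permuted.
have hps : hom_seq [seq p k | k <- enum 'I_n].
  by move=> _ /mapP[k _ ->]; apply: hx.
rewrite -unshuffle_bigsum -[RHS](derived_unshuffle hps).
apply: eq_unshuffle => A B AB.
have lt_A : (size A < n.+1)%N.
  move: (perm_size AB); rewrite size_cat size_map size_enum_ord => <-.
  by rewrite ltnS leq_addr.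
(* The unshuffle sum also contains the splitting with [A] empty, which the sum over [1 <= i] omits;
   its term vanishes because [derived_op [::]] is [pr Om = 0]. *)
have [A0 | A_gt0] := posnP (size A); last first.
  rewrite -big_mkcond (eq_bigl (pred1 (size A))) => [|i]; last exact: eq_sym.
  by rewrite big_nat1_eq A_gt0 lt_A.
rewrite big_nat big1 => [|i /andP[i_gt0 _]]; last by rewrite A0 ltn_eqF.
case: A A0 AB {lt_A} => // _ AB; have [_ hB] := hom_seq_perm AB hps.
rewrite -[_ :: _]/(map snd ((0, derived_op [::]) :: B)) derivedE /=.
rewrite {1}/derived_op /=.
by rewrite Om_pr emb0 (lie0r Om_hom) ad0 // pr0.
Qed.
End HigherDerivedBrackets.

(** * Cochains on [g + V] *)

Section GradedSubspaces.
Variables (K : fieldType) (W U : lmodType K).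

Lemma cochain_lin d (k : K) (P Q : seq (W * W) -> W -> U) :
  cochain d P -> cochain d Q -> cochain d (k *: P + Q).
Proof.
move=> [mP hP] [mQ hQ]; split; first exact: multilinear_lin.
by move=> s z sz; rewrite !fun2E hP // hQ // scaler0 addr0.
Qed.

Lemma cochain0 d : cochain d (0 : seq (W * W) -> W -> U).
Proof. by split=> //; split=> *; rewrite !fun2E scaler0 addr0. Qed.

Lemma graded_cochain : graded_subspace (@cochain K W U).
Proof.
split=> [d|d k x y|ds x ds_uniq hx sum0 d d_ds].
- exact: cochain0.
- exact: cochain_lin.
apply/funext => s; apply/funext => z; rewrite fun2E.
have [sz|sz] := eqVneq (size s)%:Z d; last exact: (hx d).2.
have := congr1 (fun P : seq (W * W) -> W -> U => P s z) sum0.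
rewrite (bigD1_seq d) //= fun2D (_ : (\sum_(_ <- _ | _) _) s z = 0) ?addr0 //.
have -> : (\sum_(i <- ds | i != d) x i) s z = \sum_(i <- ds | i != d) x i s z.
  by apply: (big_morph (fun P : seq (W * W) -> W -> U => P s z)).
by apply: big1 => i i_d; apply: (hx i).2; rewrite sz eq_sym.
Qed.

Lemma direct_sum_multilinear P : direct_sum (@cochain K W U) P -> multilinear P.
Proof.
move=> [ds [x [hx ->]]]; elim: ds => [|d ds IHds].
  by rewrite big_nil; case: (cochain0 0).
rewrite big_cons -[x d]scale1r; apply: multilinear_lin => //.
by case: (hx d).
Qed.

End GradedSubspaces.

Section BracketLie.
Variables (K : fieldType) (W : lmodType K).

Lemma cochain_bracket d e (P Q : seq (W * W) -> W -> W) :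
  cochain d P -> cochain e Q -> cochain (d + e) (bracket P Q).
Proof. by move=> hP hQ; rewrite (bracketE hP hQ); apply: cochain_gbracket. Qed.

Lemma graded_lie_bracket : graded_lie (@cochain K W W) (@bracket K W).
Proof.
split=> [d|d k P Q|d e P Q|d e k P P' Q|d e k P Q Q'|d e P Q|d e f P Q R].
- exact: cochain0.
- exact: cochain_lin.
- exact: cochain_bracket.
- by move=> hP hP' hQ; apply: bracket_linl; [case: hP|case: hP'|case: hQ].
- by move=> hP hQ hQ'; apply: bracket_linr; [case: hP|case: hQ|case: hQ'].
- move=> hP hQ; rewrite (bracketE hP hQ) (bracketE hQ hP).
  exact: gbracket_antisym.
- move=> hP hQ hR; rewrite (bracketE hP hQ) (bracketE hQ hR) (bracketE hP hR).
  rewrite (bracketE (cochain_gbracket hP hQ) hR).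
  rewrite (bracketE hP (cochain_gbracket hQ hR)).
  rewrite (bracketE (cochain_gbracket hP hR) hQ).
  exact: gbracket_jacobi.
Qed.

End BracketLie.

Section Splitting.
Variables (K : fieldType) (g V : lmodType K).
Local Notation W := (g * V)%type.
Local Notation C := (seq (W * W) -> W -> W).
Local Notation CV := (seq (V * V) -> V -> g).

Definition emb2 (X : V * V) : W * W := ((0, X.1), (0, X.2)).

Lemma incl_lin (k : K) (P Q : CV) : incl (k *: P + Q) = k *: incl P + incl Q.
Proof.
apply/funext => s; apply/funext => z; rewrite !fun2E /incl !fun2E.
by apply: injective_projections; rewrite //= scaler0 addr0.
Qed.

Lemma Pr_lin (k : K) (P Q : C) : Pr (k *: P + Q) = k *: Pr P + Pr Q.
Proof. by []. Qed.

Lemma multilinear_incl (P : CV) : multilinear P -> multilinear (incl P).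
Proof.
case=> P1 P2 P3; split=> *; rewrite /incl ?map_cat /= ?P1 ?P2 ?P3;
  by apply: injective_projections; rewrite //= scaler0 addr0.
Qed.

Lemma cochain_incl d (P : CV) : cochain d P -> cochain d (incl P).
Proof.
move=> [mP hP]; split; first exact: multilinear_incl.
by move=> s z sz; rewrite /incl hP // size_map.
Qed.

Lemma multilinear_Pr (P : C) : multilinear P -> multilinear (Pr P).
Proof.
have fst_lin (k : K) (x y : W) : (k *: x + y).1 = k *: x.1 + y.1 by [].
have emb_lin (k : K) (x y : V) : ((0, k *: x + y) : W) = k *: (0, x) + (0, y).
  by apply: injective_projections; rewrite //= scaler0 addr0.
by case=> P1 P2 P3; split=> *;
   rewrite /Pr ?map_cat /= emb_lin ?P1 ?P2 ?P3 fst_lin.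
Qed.

Lemma cochain_Pr d (P : C) : cochain d P -> cochain d (Pr P).
Proof.
move=> [mP hP]; split; first exact: multilinear_Pr.
by move=> s z sz; rewrite /Pr hP // size_map.
Qed.

Lemma inclK (P : CV) : Pr (incl P) = P.
Proof.
apply/funext => s; apply/funext => z; rewrite /Pr /incl /= -map_comp.
by congr (P _ z); rewrite -[RHS]map_id; apply: eq_map => -[].
Qed.

(** A value of [Q] has no [V]-component and so annihilates [P] wherever it is inserted. The
    hypotheses are chosen to be stable under [ins] and [alt], so that the recursion of [comp]
    preserves them. *)
Lemma comp_vanish (P Q : C) :
  (forall s1 s2 X z, X.1.2 = 0 \/ X.2.2 = 0 -> P (s1 ++ X :: s2) z = 0) ->
  (forall s z, z.2 = 0 -> P s z = 0) -> (forall s z, (Q s z).2 = 0) ->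
  comp P Q = 0.
Proof.
move=> P0 Pl0 Q0; apply/funext => s; apply/funext => z; rewrite fun20.
elim: s P Q P0 Pl0 Q0 => [|X s IHs] P Q P0 Pl0 Q0; first exact: Pl0.
rewrite [LHS]/= dins_app !(P0 [::]); [|by right; apply: Q0|by left; apply: Q0].
rewrite !IHs ?addr0 // => [t v|s1 s2 Y v Y0|t v v0|t v]; rewrite /ins /alt.
- exact: Q0.
- by rewrite -cat_cons P0.
- exact: Pl0.
- by rewrite [LHS]/= Q0 scaler0.
Qed.

Lemma comp_incl (P Q : CV) : multilinear P -> comp (incl P) (incl Q) = 0.
Proof.
move=> mP; apply: comp_vanish => // [s1 s2 X z X0|s z z0].
  rewrite /Defs.incl map_cat /=; congr pair.
  by case: X0 => ->; [apply: multilinear_fst0|apply: multilinear_snd0].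
by rewrite /Defs.incl z0 multilinear_last0.
Qed.

Lemma bracket_incl d e (P Q : CV) : cochain d P -> cochain e Q ->
  bracket (incl P) (incl Q) = 0.
Proof.
move=> hP hQ; rewrite (bracketE (cochain_incl hP) (cochain_incl hQ)) /gbracket.
by rewrite !comp_incl ?scaler0 ?subr0; [|case: hQ|case: hP].
Qed.

(** [Pr P = 0] says that [P] sends arguments in [V] to a value in [V], a property that survives
    insertion of one such map into another. *)
Lemma Pr_comp (P Q : C) : Pr P = 0 -> Pr Q = 0 -> Pr (comp P Q) = 0.
Proof.
have PrE (R : C) : Pr R = 0 ->
    forall s v, exists w, R (map emb2 s) (0, v) = (0, w).
  move=> R0 s v; exists (R (map emb2 s) (0, v)).2.
  rewrite {1}[R _ _]surjective_pairing; congr pair.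
  by rewrite -[LHS]/(Pr R s v) R0.
move=> P0 Q0; apply/funext => s; apply/funext => v; rewrite fun20.
elim: s P Q P0 Q0 => [|X s IHs] P Q P0 Q0.
  have [w Qv] := PrE _ Q0 [::] v; have [w' Pw] := PrE _ P0 [::] w.
  by rewrite /Pr /= Qv Pw.
rewrite -[LHS]/((comp (ins (emb2 X) P) (alt Q) (map emb2 s) (0, v)).1
  + (comp P (ins (emb2 X) Q) (map emb2 s) (0, v)).1
  + (dins (Q [::]) (emb2 X) P (map emb2 s) (0, v)).1).
have insE (R : C) : Pr R = 0 -> Pr (ins (emb2 X) R) = 0.
  move=> R0; apply/funext => t.
  exact: (congr1 (fun f : CV => f (X :: t)) R0).
rewrite -![(comp _ _ _ _).1]/(Pr (comp _ _) s v) !IHs ?insE //; last first.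
  apply/funext => t; apply/funext => w.
  rewrite /Pr /alt /= -[(R in _ *: R)]/(Pr Q t w).
  by rewrite Q0 scaler0.
have [[w1 Q1] [w2 Q2]] := (PrE _ Q0 [::] X.1, PrE _ Q0 [::] X.2).
rewrite !add0r dins_app [Q [::] (emb2 X).1]Q1 [Q [::] (emb2 X).2]Q2.
rewrite -[LHS]/(Pr P ((w1, X.2) :: s) v + Pr P ((X.1, w2) :: s) v).
by rewrite P0 addr0.
Qed.

Lemma Pr_bracket d e (P Q : C) : cochain d P -> cochain e Q ->
  Pr P = 0 -> Pr Q = 0 -> Pr (bracket P Q) = 0.
Proof.
move=> hP hQ P0 Q0; rewrite (bracketE hP hQ) /gbracket addrC -scaleNr Pr_lin.
by rewrite !Pr_comp // scaler0 addr0.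
Qed.

(* Weights, that is, the number of arguments in [V] minus the number of values
   in [V], are detected by the dilation acting as [id] on [g] and [2] on [V]:
   weight [w] amounts to [weighted (2 ^ w)]. *)
Definition dil (x : W) : W := (x.1, (2 : K) *: x.2).
Definition dil2 (X : W * W) : W * W := (dil X.1, dil X.2).
Definition weighted (c : K) (P P' : C) : Prop :=
  forall s z, P' (map dil2 s) (dil z) = c *: dil (P s z).

Lemma dilZ c x : dil (c *: x) = c *: dil x.
Proof. by rewrite /dil /= scalerA mulrC -scalerA. Qed.

Lemma dilD x y : dil (x + y) = dil x + dil y.
Proof. by rewrite /dil /= scalerDr. Qed.

(** Two versions of each cochain are carried because the recursion inserts [X] into [P] but [dil2 X]
    into [P']; the case of interest has [P' = P] and [Q' = Q]. *)
Lemma weighted_comp c d (P P' Q Q' : C) : multilinear P' ->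
  weighted c P P' -> weighted d Q Q' ->
  weighted (c * d) (comp P Q) (comp P' Q').
Proof.
move=> mP' wP wQ s z.
elim: s P P' Q Q' mP' wP wQ => [|X s IHs] P P' Q Q' mP' wP wQ.
  rewrite /= (wQ [::] z) -[_ *: _]addr0 (multilinear_last mP').
  rewrite (multilinear_last0 _ mP') addr0 (wP [::]) scalerA.
  by rewrite mulrC.
rewrite /= (IHs (ins X P) _ (alt Q)); first last.
- by move=> t v; rewrite /alt size_map wQ dilZ !scalerA mulrC.
- by move=> t v; apply: (wP (X :: t)).
- exact: multilinear_ins.
rewrite (IHs P _ (ins X Q)) //; last by move=> t v; apply: (wQ (X :: t)).
rewrite !dilD !scalerDr; congr (_ + _); rewrite !dins_app !(wQ [::]).
have lin1 x y : P' ((d *: x, y) :: map dil2 s) (dil z) =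
    d *: P' ((x, y) :: map dil2 s) (dil z).
  rewrite -[d *: x]addr0 (multilinear_fst mP' [::]).
  by rewrite (multilinear_fst0 [::] _ _ _ mP') addr0.
have lin2 x y : P' ((x, d *: y) :: map dil2 s) (dil z) =
    d *: P' ((x, y) :: map dil2 s) (dil z).
  rewrite -[d *: y]addr0 (multilinear_snd mP' [::]).
  by rewrite (multilinear_snd0 [::] _ _ _ mP') addr0.
rewrite lin1 lin2 (wP ((Q [::] X.1, X.2) :: s)) (wP ((X.1, Q [::] X.2) :: s)).
by rewrite !scalerA -!scalerDr -dilD [d * c]mulrC.
Qed.

Lemma weighted_bracket c d e f (P Q : C) : cochain e P -> cochain f Q ->
  weighted c P P -> weighted d Q Q ->
  weighted (c * d) (bracket P Q) (bracket P Q).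
Proof.
move=> hP hQ wP wQ s z; rewrite (bracketE hP hQ) /gbracket !fun2E.
rewrite (weighted_comp hP.1 wP wQ) (weighted_comp hQ.1 wQ wP).
rewrite dilD -scaleNr -[- (_ *: comp _ _ _ _)]scaleNr dilZ.
by rewrite scalerDr !scalerA; congr (_ + _ *: _); ring.
Qed.

Definition dbl (X : V * V) : V * V := ((2 : K) *: X.1, (2 : K) *: X.2).

Lemma multilinear_dbl (U : lmodType K) (P : seq (V * V) -> V -> U) s v :
  multilinear P ->
  P (map dbl s) ((2 : K) *: v) = (2 : K) ^+ (size s * 2 + 1) *: P s v.
Proof.
elim: s P => [|X s IHs] P mP.
  have := multilinear_last mP [::] 2 v 0.
  by rewrite !addr0 multilinear_last0 ?addr0.
have lin1 x y : ins ((2 : K) *: x, y) P = (2 : K) *: ins (x, y) P.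
  apply/funext => t; apply/funext => w; rewrite fun2Z /ins -[_ *: x]addr0.
  by rewrite (multilinear_fst mP [::]) (multilinear_fst0 [::]) ?addr0.
have lin2 x y : ins (x, (2 : K) *: y) P = (2 : K) *: ins (x, y) P.
  apply/funext => t; apply/funext => w; rewrite fun2Z /ins -[_ *: y]addr0.
  by rewrite (multilinear_snd mP [::]) (multilinear_snd0 [::]) ?addr0.
rewrite -[LHS]/(ins (dbl X) P (map dbl s) (2 *: v)) lin1 lin2 !fun2Z.
rewrite IHs; last exact: multilinear_ins.
rewrite !scalerA -surjective_pairing -?mulrA -!exprS.
by [].
Qed.

Hypothesis charK : forall n, (n%:R == 0 :> K) = (n == 0%N).

Lemma two_neq0 : (2 : K) != 0. Proof. by rewrite charK. Qed.

Lemma weighted_incl d (P : CV) : cochain d P ->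
  weighted ((2 : K) ^ (d * 2 + 1)) (incl P) (incl P).
Proof.
move=> [mP hP] s z; rewrite /dil /Defs.incl /=.
have -> : [seq (X.1.2, X.2.2) | X <- map dil2 s] =
    map dbl [seq (X.1.2, X.2.2) | X <- s] by rewrite -!map_comp.
rewrite multilinear_dbl //.
apply: injective_projections; rewrite /= ?scaler0 //.
rewrite size_map; have [<-|sz] := eqVneq (size s)%:Z d.
  by rewrite -PoszM -PoszD.
by rewrite hP ?size_map // !scaler0.
Qed.

(** On [2 d + 1] arguments in [V] with value in [g], the dilation multiplies by [2 ^ (d * 2 + 1)] by
    multilinearity and by [c] by weight. *)
Lemma weighted_Pr c d (P : C) : cochain d P -> weighted c P P ->
  c != (2 : K) ^ (d * 2 + 1) -> Pr P = 0.
Proof.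
move=> hP wP c_d; apply/funext => s; apply/funext => v; rewrite fun20.
have [sz|sz] := eqVneq (size s)%:Z d; last exact: (cochain_Pr hP).2.
have := congr1 fst (wP (map emb2 s) (0, v)).
have -> : map dil2 (map emb2 s) = map emb2 (map dbl s) by rewrite -!map_comp.
rewrite -[X in X = _]/(Pr P (map dbl s) (2 *: v)).
rewrite multilinear_dbl; last exact: multilinear_Pr hP.1.
rewrite -[X in _ = X]/(c *: Pr P s v) => /eqP; rewrite -subr_eq0 -scalerBl.
rewrite scaler_eq0 subr_eq0 => /orP[/eqP cd|/eqP//].
by move: c_d; rewrite -cd -sz -PoszM -PoszD eqxx.
Qed.

(** In characteristic 0 the scalar 2 is not a root of unity, so the dilation separates all
    weights. *)
Lemma exp2_inj (m n : int) : (2 : K) ^ m = 2 ^ n -> m = n.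
Proof.
have pos (k : nat) (m' : int) : (2 : K) ^ (m' + k%:Z) = 2 ^ m' -> k = 0%N.
  rewrite expfzDr ?two_neq0 // => /(canRL (mulKf (expfz_neq0 _ two_neq0))).
  rewrite mulVf ?expfz_neq0 ?two_neq0 // => /eqP.
  rewrite -exprnP -natrX -[X in _ == X]mulr1n -subr_eq0.
  rewrite -natrB ?expn_gt0 // charK subn_eq0.
  by case: k => // k; rewrite leqNgt -{1}(expn0 2) ltn_exp2l.
move=> eq_mn; have [[k nE]|[k mE]] :
    (exists k : nat, n = m + k%:Z) \/ (exists k : nat, m = n + k%:Z).
- case: (leP m n) => mn; [left; exists `|n - m|%N|right; exists `|m - n|%N];
    by lia.
- by move: eq_mn; rewrite nE => /esym/pos->; rewrite addr0.
- by move: eq_mn; rewrite mE => /pos->; rewrite addr0.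
Qed.

Lemma ad_cochain_weighted (a : C) c d (ps : seq (int * CV)) :
  cochain d a -> weighted c a a ->
  (forall p, p \in ps -> cochain p.1 p.2) ->
  let F := ad (@bracket K W) (@Defs.incl K g V) a ps in
  cochain (d + degs fst ps) F
  /\ weighted (c * (2 : K) ^ (degs fst ps * 2 + (size ps)%:Z)) F F.
Proof.
elim: ps a c d => [|p ps IHps] a c d ha wa hps.
  by rewrite /degs big_nil addr0 expr0z mulr1.
have hp : cochain p.1 p.2 by apply: hps; rewrite mem_head.
have hep := cochain_incl hp; have hap := cochain_bracket ha hep.
have wap := weighted_bracket ha hep wa (weighted_incl hp).
have := IHps _ _ _ hap wap => /(_ _)[] => [q qs|hF wF].
  by apply: hps; rewrite in_cons qs orbT.
rewrite degs_cons addrA; split=> //=.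
suff -> : (p.1 + degs fst ps) * 2 + (size ps).+1%:Z =
  (p.1 * 2 + 1) + (degs fst ps * 2 + (size ps)%:Z).
  by rewrite expfzDr ?two_neq0 // mulrA.
by rewrite intS; ring.
Qed.

End Splitting.

(** * The structure cochain and twisted Rota-Baxter operators *)

Section Trilinear.
Variables (K : fieldType) (A B C D : lmodType K) (f : A -> B -> C -> D).
Hypothesis tf : trilinear f.

Lemma trilinear0l y z : f 0 y z = 0.
Proof. by have := trilinear1 tf y z (-1) 0 0; rewrite !scaleN1r !addNr. Qed.
Lemma trilinear0m x z : f x 0 z = 0.
Proof. by have := trilinear2 tf x z (-1) 0 0; rewrite !scaleN1r !addNr. Qed.
Lemma trilinear0r x y : f x y 0 = 0.
Proof. by have := trilinear3 tf x y (-1) 0 0; rewrite !scaleN1r !addNr. Qed.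
Lemma trilinearDl x x' y z : f (x + x') y z = f x y z + f x' y z.
Proof. by have := trilinear1 tf y z 1 x x'; rewrite !scale1r. Qed.
Lemma trilinearDm x y y' z : f x (y + y') z = f x y z + f x y' z.
Proof. by have := trilinear2 tf x z 1 y y'; rewrite !scale1r. Qed.
Lemma trilinearDr x y z z' : f x y (z + z') = f x y z + f x y z'.
Proof. by have := trilinear3 tf x y 1 z z'; rewrite !scale1r. Qed.

Lemma trilinearZl k x y z : f (k *: x) y z = k *: f x y z.
Proof. by rewrite -[k *: x]addr0 (trilinear1 tf) trilinear0l addr0. Qed.
Lemma trilinearZm k x y z : f x (k *: y) z = k *: f x y z.
Proof. by rewrite -[k *: y]addr0 (trilinear2 tf) trilinear0m addr0. Qed.
Lemma trilinearZr k x y z : f x y (k *: z) = k *: f x y z.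
Proof. by rewrite -[k *: z]addr0 (trilinear3 tf) trilinear0r addr0. Qed.

End Trilinear.

Lemma trilinear_zero (K : fieldType) (A B C D : lmodType K) :
  trilinear (fun (_ : A) (_ : B) (_ : C) => 0 : D).
Proof. by split=> *; rewrite scaler0 addr0. Qed.

Section OmegaLinear.
Variables (K : fieldType) (g V : lmodType K).
Variables (br : g -> g -> g -> g)
  (rl : g -> g -> V -> V) (rm : g -> V -> g -> V) (rr : V -> g -> g -> V)
  (Phi : g -> g -> g -> V).
Hypotheses (tbr : trilinear br) (trl : trilinear rl) (trm : trilinear rm)
  (trr : trilinear rr) (tPhi : trilinear Phi).
Local Notation W := (g * V)%type.
Local Notation Om := (Omega br rl rm rr Phi).

Lemma trilinear_Omega : trilinear (fun x y z : W => Om [:: (x, y)] z).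
Proof.
split=> *; apply: injective_projections => /=.
- exact: trilinear1 tbr _ _ _ _ _.
- by rewrite (trilinear1 trl) (trilinear1 trm) (trilinear1 trr)
             (trilinear1 tPhi); lmod K V.
- exact: trilinear2 tbr _ _ _ _ _.
- by rewrite (trilinear2 trl) (trilinear2 trm) (trilinear2 trr)
             (trilinear2 tPhi); lmod K V.
- exact: trilinear3 tbr _ _ _ _ _.
- by rewrite (trilinear3 trl) (trilinear3 trm) (trilinear3 trr)
             (trilinear3 tPhi); lmod K V.
Qed.

Lemma cochain_Omega : cochain 1 Om.
Proof.
have [t1 t2 t3] := trilinear_Omega.
split; last by case=> [|[x y] [|X s]].
split=> [s1 s2 k x x' y z|s1 s2 k x y y' z|s k z z'].
- case: s1 => [|[? ?] [|? ?]]; case: s2 => [|? ?];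
    by [apply: t1|rewrite /= scaler0 addr0].
- case: s1 => [|[? ?] [|? ?]]; case: s2 => [|? ?];
    by [apply: t2|rewrite /= scaler0 addr0].
- by case: s => [|[? ?] [|? ?]]; by [apply: t3|rewrite /= scaler0 addr0].
Qed.

End OmegaLinear.

Lemma truncated_sum (E : nmodType) (F : nat -> E) m n :
  (m <= n)%N -> (forall k, (m <= k)%N -> F k = 0) ->
  \sum_(1 <= k < n) F k = \sum_(1 <= k < m) F k.
Proof.
move=> le_mn F0; rewrite (big_nat_widen _ _ _ _ _ le_mn) [RHS]big_mkcond.
by apply: eq_bigr => k _; case: ltnP => [//|/F0].
Qed.

(** The bound [N] may lie on either side of 5; both truncations omit only zero terms, so their sums
    agree. *)
Lemma exp_series34 (K : fieldType) (E : lmodType K) (G : nat -> E) :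
  (forall k, k != 3 -> k != 4 -> G k = 0) ->
  (exists N : nat, (forall k, (N <= k)%N -> G k = 0) /\
    \sum_(1 <= k < N) (k`!%:R : K)^-1 *: G k = 0) <->
  (3`!%:R : K)^-1 *: G 3 + (4`!%:R : K)^-1 *: G 4 = 0.
Proof.
move=> G0; pose F k := (k`!%:R : K)^-1 *: G k.
have F0 n : (forall k, (n <= k)%N -> G k = 0) ->
    forall k, (n <= k)%N -> F k = 0.
  by move=> Gn k /Gn; rewrite /F => ->; rewrite scaler0.
have G5 k : (5 <= k)%N -> G k = 0.
  by move=> k5; apply: G0; apply: contraL k5 => /eqP->.
have F5 : \sum_(1 <= k < 5) F k = F 3 + F 4.
  do 4 rewrite big_ltn //.
  by rewrite big_geq // addr0 {1 2}/F !(G0 1, G0 2) // !scaler0 !add0r.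
rewrite -[X in _ <-> X]/(F 3 + F 4 = 0) -F5.
split=> [[N [GN sumN]]|sum0]; last by exists 5.
rewrite -[RHS]sumN; have [le_N|/ltnW le_N] := leqP N 5.
  exact: truncated_sum le_N (F0 _ GN).
by symmetry; apply: truncated_sum le_N (F0 _ G5).
Qed.

(** * The L-infinity algebra attached to a representation and a cocycle *)

Section Main.
Variables (K : fieldType) (g V : lmodType K).
Variables (br : g -> g -> g -> g)
  (rl : g -> g -> V -> V) (rm : g -> V -> g -> V) (rr : V -> g -> g -> V)
  (Phi : g -> g -> g -> V).
Hypotheses (Hg : is_3Leibniz br) (HV : is_representation br rl rm rr)
  (HPhi : is_2cocycle br rl rm rr Phi).
Hypothesis charK : forall n, (n%:R == 0 :> K) = (n == 0%N).
Local Notation W := (g * V)%type.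
Local Notation Om := (Omega br rl rm rr Phi).
Local Notation om x y z := (Om [:: (x, y)] z).
Local Notation CV := (seq (V * V) -> V -> g).

Let tbr := leib_trilinear Hg.
Let trl := rep_l HV.
Let trm := rep_m HV.
Let trr := rep_r HV.
Let tPhi := coc_trilinear HPhi.

Let hOm : cochain 1 Om := cochain_Omega tbr trl trm trr tPhi.

(** The twisted semidirect product is a 3-Leibniz algebra. In the [V]-component, each of the five
    representation axioms treats one position of a single argument from [V], and the cocycle
    identity treats the terms with none. *)
Lemma omega_leibniz (a b x y z : W) :
  om a b (om x y z) = om (om a b x) y z + om x (om a b y) z + om x y (om a b z).
Proof.
apply: injective_projections => /=; first exact: (leib_identity Hg).
have := coc_identity HPhi a.1 b.1 x.1 y.1 z.1.
rewrite !(trilinearDl trr) !(trilinearDm trm) !(trilinearDr trl).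
rewrite (rep_ll HV) (rep_lm HV) (rep_lr HV).
rewrite (rep_mb HV a.1 b.2) (rep_rb HV a.2 b.1).
move=> /(canRL (addrK _)) ->.
by lmod K V.
Qed.

Lemma bracket_Omega : bracket Om Om = 0.
Proof.
suff OO : comp Om Om = 0.
  by rewrite (bracketE hOm hOm) /gbracket OO scaler0 subr0.
apply/funext => s; apply/funext => z; rewrite fun20.
case: s => [|[x y] [|[x' y'] [|X s]]]; try by apply: (cochain_comp hOm hOm).2.
(* The recursion of [comp] unfolded on two pairs; [Om] vanishes on lists of any length but 1, and
   the four surviving terms are the two sides of [omega_leibniz] with opposite signs. *)
transitivity (0 + om x y ((-1) ^+ 1 *: om x' y' z) + (0 + 0) +
  (om x' y' ((-1) ^+ 0 *: om x y z) + 0 +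
     (om (om x y x') y' z + om x' (om x y y') z)) + (0 + 0)) => //.
have tOm := trilinear_Omega tbr trl trm trr tPhi.
rewrite !(trilinearZr tOm) omega_leibniz expr1 expr0.
by lmod K (g * V)%type.
Qed.

Lemma omega_pr : Pr Om = 0.
Proof.
apply/funext => s; apply/funext => v; rewrite /Pr.
case: s => [|[x y] [|X s]] //=; apply: (trilinear0l tbr).
Qed.

Local Notation derived :=
  (derived_op (@bracket K W) (@Defs.incl K g V) (@Pr K g V) Om).

(* [Om0] has weight 0 and [OmPhi] has weight -1, while an embedded cochain of
   degree [d] has weight [2 d + 1] and [Pr] sees only weight [2 d + 1] in degree
   [d]: hence only the ternary and quaternary brackets survive. *)
Let Om0 := Omega br rl rm rr (fun _ _ _ => 0).
Let OmPhi := Omega (fun _ _ _ => 0 : g) (fun _ _ _ => 0 : V) (fun _ _ _ => 0)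
  (fun _ _ _ => 0) Phi.

Lemma Omega_split : Om = Om0 + OmPhi.
Proof.
apply/funext => s; apply/funext => z; rewrite fun2D.
case: s => [|[x y] [|X s]]; rewrite /= ?addr0 //.
by apply: injective_projections; rewrite /= ?addr0 // !add0r.
Qed.

Let hOm0 : cochain 1 Om0.
Proof. by apply: cochain_Omega => //; apply: trilinear_zero. Qed.

Let hOmPhi : cochain 1 OmPhi.
Proof. by apply: cochain_Omega => //; apply: trilinear_zero. Qed.

Lemma weighted_Om0 : weighted 1 Om0 Om0.
Proof.
move=> s z; rewrite scale1r.
case: s => [|[x y] [|X s]]; try by rewrite /= /dil /= scaler0.
apply: injective_projections => //=; rewrite !addr0 !scalerDr.
by rewrite (trilinearZr trl) (trilinearZm trm) (trilinearZl trr).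
Qed.

Lemma weighted_OmPhi : weighted (2 ^ (-1)) OmPhi OmPhi.
Proof.
move=> s z; case: s => [|[x y] [|X s]]; try by rewrite /= /dil /= !scaler0.
apply: injective_projections; rewrite /= ?scaler0 // !add0r scalerA.
by rewrite mulVf ?scale1r // two_neq0.
Qed.

(** With [n] entries of total degree [D], the iterated bracket has degree [D + 1], where [Pr] sees
    only weight [2 D + 3]. The part from [Om0] has weight [2 D + n] and the part from [OmPhi] has
    weight [2 D + n - 1], which forces [n = 3] and [n = 4] respectively. *)
Lemma derived_vanish (ps : seq (int * CV)) :
  (forall p, p \in ps -> cochain p.1 p.2) -> size ps != 3 -> size ps != 4 ->
  derived (map snd ps) = 0.
Proof.
move=> hps n3 n4; rewrite derivedE.
have [h0 w0] := ad_cochain_weighted charK hOm0 weighted_Om0 hps.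
have [hP wP] := ad_cochain_weighted charK hOmPhi weighted_OmPhi hps.
have -> : ad (@bracket K W) (@Defs.incl K g V) Om ps =
    1 *: ad (@bracket K W) (@Defs.incl K g V) Om0 ps +
    ad (@bracket K W) (@Defs.incl K g V) OmPhi ps.
  rewrite Omega_split -[Om0 in LHS]scale1r.
  exact: (ad_lin (graded_lie_bracket (g * V)%type) (@cochain_incl K g V) 1
            hOm0 hOmPhi hps).
rewrite Pr_lin (weighted_Pr h0 w0) ?(weighted_Pr hP wP) ?scaler0 ?addr0 //.
  rewrite -expfzDr ?two_neq0 //; apply/eqP => /(exp2_inj charK).
  by move/eqP: n4; lia.
rewrite mul1r; apply/eqP => /(exp2_inj charK).
by move/eqP: n3; lia.
Qed.

Lemma linf_opE (ps : seq (int * CV)) :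
  (forall p, p \in ps -> cochain p.1 p.2) -> (0 < size ps)%N ->
  linf_op br rl rm rr Phi (map snd ps) = derived (map snd ps).
Proof.
move=> hps ps_gt0; have [n3|n3] := eqVneq (size ps) 3.
  by case: ps n3 {hps ps_gt0} => [|p [|q [|r []]]].
have [n4|n4] := eqVneq (size ps) 4.
  by case: ps n4 {hps ps_gt0 n3} => [|p [|q [|r [|t []]]]].
rewrite derived_vanish //.
by case: ps n3 n4 {hps ps_gt0} => [|p [|q [|r [|t [|o ps]]]]].
Qed.

Lemma linf_op_size (xs : seq CV) :
  linf_op br rl rm rr Phi xs =
  if (size xs == 3) || (size xs == 4) then derived xs else 0.
Proof. by case: xs => [|x [|y [|z [|t []]]]]. Qed.

(** The entries may be inhomogeneous, so [ad_lin] does not apply; linearity is taken from the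
    bracket of arbitrary multilinear cochains. *)
Lemma derived_lin (s1 s2 : seq CV) k x y :
  (forall z, z \in s1 ++ s2 -> multilinear z) ->
  multilinear x -> multilinear y ->
  derived (s1 ++ (k *: x + y) :: s2) =
  k *: derived (s1 ++ x :: s2) + derived (s1 ++ y :: s2).
Proof.
move=> ms mx my; rewrite /derived_op -Pr_lin; congr Pr.
pose B := foldl (fun b (z : CV) => bracket b (incl z)).
have mB s a : multilinear a -> (forall z, z \in s -> multilinear z) ->
    multilinear (B a s).
  elim: s a => //= z s IHs a ma mz; apply: IHs => [|t ts]; last first.
    by apply: mz; rewrite in_cons ts orbT.
  by apply: multilinear_bracket => //; apply/multilinear_incl/mz/mem_head.
have linB s a b : multilinear a -> multilinear b ->
    (forall z, z \in s -> multilinear z) ->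
    B (k *: a + b) s = k *: B a s + B b s.
  elim: s a b => //= z s IHs a b ma mb mz.
  have mez : multilinear (incl z) by apply/multilinear_incl/mz/mem_head.
  rewrite bracket_linl // IHs //; try exact: multilinear_bracket.
  by move=> t ts; apply: mz; rewrite in_cons ts orbT.
have mBs1 : multilinear (B Om s1).
  by apply: mB hOm.1 _ => z zs; apply: ms; rewrite mem_cat zs.
have [mex mey] := conj (multilinear_incl mx) (multilinear_incl my).
rewrite !foldl_cat /= -/B incl_lin bracket_linr // linB //;
  try exact: multilinear_bracket.
by move=> z zs; apply: ms; rewrite mem_cat zs orbT.
Qed.

Lemma linf_op_hom (ps : seq (int * CV)) :
  (forall p, p \in ps -> cochain p.1 p.2) -> (0 < size ps)%N ->
  cochain (1 + degs fst ps) (linf_op br rl rm rr Phi (map snd ps)).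
Proof.
move=> hps ps_gt0; rewrite linf_opE //.
exact: (derived_hom (graded_lie_bracket (g * V)%type) (@cochain_incl K g V)
          (@cochain_Pr K g V) hOm hps).
Qed.

Lemma linf_op_derived n (d : 'I_n -> int) (x : 'I_n -> CV) (s : 'S_n) :
  (0 < n)%N -> (forall i, cochain (d i) (x i)) ->
  linf_op br rl rm rr Phi (permuted s x) = derived (permuted s x).
Proof.
move=> n_gt0 hx; pose p i := (d i, x i).
rewrite -[permuted s x](map_permuted snd s p) linf_opE ?size_permuted //.
by move=> _ /mapP[i _ ->]; apply: hx.
Qed.

Lemma permuted1 (X : Type) n (x : 'I_n -> X) :
  permuted 1 x = [seq x i | i <- enum 'I_n].
Proof. by apply: eq_map => i; rewrite perm1. Qed.

Theorem Linfty_cochain :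
  is_Linfty (@cochain K V g) (linf_op br rl rm rr Phi).
Proof.
have gl := graded_lie_bracket (g * V)%type.
have hincl := @cochain_incl K g V.
have hPr := @cochain_Pr K g V.
have ab := @bracket_incl K g V.
split=> [|s1 s2 k x y hs hx hy|n d x n_gt0 hx|n d x s n_gt0 hx|n d x n_gt0 hx].
- exact: graded_cochain.
- rewrite !linf_op_size !size_cat /=; case: ifP => _; last first.
    by rewrite scaler0 addr0.
  apply: derived_lin; try exact: direct_sum_multilinear.
  by move=> z zs; apply/direct_sum_multilinear/hs.
- pose p i := (d i, x i).
  have hp q : q \in [seq p i | i <- enum 'I_n] -> cochain q.1 q.2.
    by move=> /mapP[i _ ->]; apply: hx.
  have := linf_op_hom hp; rewrite size_map size_enum_ord.
  have -> : map snd [seq p i | i <- enum 'I_n] = [seq x i | i <- enum 'I_n].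
    by rewrite -map_comp.
  by rewrite /degs big_map big_enum addrC; apply.
- rewrite -permuted1 !(linf_op_derived _ n_gt0 hx) permuted1.
  exact: (derived_symmetric gl (@Pr_lin K g V) hincl ab hOm).
- rewrite -[RHS](derived_jacobi gl (@incl_lin K g V) (@Pr_lin K g V) hincl hPr
    (@inclK K g V) ab (@Pr_bracket K g V) hOm omega_pr bracket_Omega
    (two_neq0 charK) hx).
  rewrite big_nat [RHS]big_nat; apply: eq_bigr => i /andP[i_gt0 lt_i].
  apply: eq_bigr => s _; congr (_ *: _).
  pose p i := (d i, x i); pose t := permuted s p.
  have ht q : q \in t -> cochain q.1 q.2 by case/mapP=> j _ ->; apply: hx.
  have sz_t : size t = n by rewrite size_permuted.
  have -> : permuted s x = map snd t by rewrite map_permuted.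
  have sz_it : size (take i t) = i by rewrite size_takel ?sz_t.
  rewrite -map_take -map_drop.
  have hA q : q \in take i t -> cochain q.1 q.2 by move=> /mem_take/ht.
  have hB q : q \in drop i t -> cochain q.1 q.2 by move=> /mem_drop/ht.
  have hl := linf_op_hom hA; rewrite sz_it in hl; have {}hl := hl i_gt0.
  rewrite linf_opE ?sz_it // in hl *.
  (* The inner value enters the outer list with the degree supplied by [linf_op_hom], so [linf_opE]
     applies again. *)
  pose q := (1 + degs fst (take i t), derived (map snd (take i t))).
  rewrite -[_ :: _]/(map snd (q :: drop i t)) linf_opE //.
  by move=> r; rewrite in_cons => /predU1P[->|/hB].
Qed.

(** * The Maurer-Cartan equation for a linear operator *)

Section MaurerCartan.
Variable T : {linear V -> g}.
Let t : CV := cochain_of_linear T.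

Lemma cochain_linear : cochain 0 t.
Proof.
split; last by case.
split=> [[] *|[] *|[|? ?] *]; rewrite /t /= ?scaler0 ?addr0 //.
by rewrite linearP.
Qed.

Let tau (x : W) : W := (T x.2, 0).

Lemma bracket_linear (P : seq (W * W) -> W -> W) x y z : cochain 1 P ->
  bracket P (incl t) [:: (x, y)] z =
  P [:: (x, y)] (tau z) + P [:: (tau x, y)] z + P [:: (x, tau y)] z
  - tau (P [:: (x, y)] z).
Proof.
move=> hP; have ht := cochain_incl cochain_linear.
rewrite (bracketE hP ht) /gbracket !fun2E.
rewrite (comp_cons _ _ _ hP.1 ht) (comp_cons _ _ _ ht.1 hP) /=.
rewrite !dins_app /ins /=.
have t1 X w : incl t [:: X] w = 0 by [].
rewrite !t1 -![incl t [::] _]/(tau _) (multilinear_last0 _ hP.1).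
by rewrite mulr0 !expr0z !scale1r !scaler0; lmod K (g * V)%type.
Qed.

Let tauD x y : tau (x + y) = tau x + tau y.
Proof. by apply: injective_projections; rewrite /= ?linearD ?addr0. Qed.
Let tauN x : tau (- x) = - tau x.
Proof. by apply: injective_projections; rewrite /= ?linearN ?oppr0. Qed.
Let tauZ k x : tau (k *: x) = k *: tau x.
Proof. by apply: injective_projections; rewrite /= ?linearZ ?scaler0. Qed.
Let tau0 : tau 0 = 0.
Proof. by apply: injective_projections; rewrite /= ?linear0. Qed.
Let tautau x : tau (tau x) = 0.
Proof. by apply: injective_projections; rewrite /= ?linear0. Qed.

Let B1 := bracket Om (incl t).
Let B2 := bracket B1 (incl t).
Let B3 := bracket B2 (incl t).
Let B4 := bracket B3 (incl t).

Let hbr P : cochain 1 P -> cochain 1 (bracket P (incl t)).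
Proof.
move=> hP; have := cochain_bracket hP (cochain_incl cochain_linear).
by rewrite addr0.
Qed.

Let tOm := trilinear_Omega tbr trl trm trr tPhi.
Let omE := (tauD, tauN, tauZ, tau0, tautau, trilinear0l tOm, trilinear0m tOm,
  trilinear0r tOm).

(** By [bracket_linear], bracketing with [incl t] is a sum of four commuting operations of square
    zero: [tau] in each of the three slots, and minus [tau] on the value. Its n-th power is n! times
    the sum of the products of n distinct ones, whence the constants 2, 6 and 24 here and below. *)
Lemma bracket_linear2 x y z : B2 [:: (x, y)] z =
  2 *: (om x (tau y) (tau z) + om (tau x) y (tau z) + om (tau x) (tau y) z
   - tau (om x y (tau z) + om (tau x) y z + om x (tau y) z)).
Proof.
rewrite /B2 (bracket_linear _ _ _ (hbr hOm)) !(bracket_linear _ _ _ hOm).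
by rewrite !omE; lmod K (g * V)%type.
Qed.

Lemma bracket_linear3 x y z : B3 [:: (x, y)] z =
  6 *: (om (tau x) (tau y) (tau z)
   - tau (om x (tau y) (tau z) + om (tau x) y (tau z) + om (tau x) (tau y) z)).
Proof.
rewrite /B3 (bracket_linear _ _ _ (hbr (hbr hOm))) -/B1 -/B2 !bracket_linear2.
by rewrite !omE; lmod K (g * V)%type.
Qed.

Lemma bracket_linear4 x y z : B4 [:: (x, y)] z =
  - (24 *: tau (om (tau x) (tau y) (tau z))).
Proof.
rewrite /B4 (bracket_linear _ _ _ (hbr (hbr (hbr hOm)))) -/B1 -/B2 -/B3.
by rewrite !bracket_linear3 !omE; lmod K (g * V)%type.
Qed.

Local Notation l3 := (l3 br rl rm rr Phi).
Local Notation l4 := (l4 br rl rm rr Phi).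

Lemma l3_linear u v w : l3 t t t [:: (u, v)] w =
  6 *: (br (T u) (T v) (T w)
        - T (rl (T u) (T v) w + rm (T u) v (T w) + rr u (T v) (T w))).
Proof.
rewrite -[LHS]/(B3 [:: ((0, u), (0, v))] (0, w)).1 bracket_linear3 /=.
rewrite !(trilinear0l trr, trilinear0m trm, trilinear0r trl, trilinear0l tPhi,
  trilinear0m tPhi, trilinear0r tPhi, add0r, addr0).
by congr (_ *: (_ - T _)); lmod K V.
Qed.

(** Only the product of all four operations remains; on three arguments in [g] the [V]-component of
    [Om] is [Phi] alone. *)
Lemma l4_linear u v w : l4 t t t t [:: (u, v)] w =
  - (24 *: T (Phi (T u) (T v) (T w))).
Proof.
rewrite -[LHS]/(B4 [:: ((0, u), (0, v))] (0, w)).1 bracket_linear4 /=.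
by rewrite !(trilinear0l trr, trilinear0m trm, trilinear0r trl, add0r).
Qed.

(** The left side [F] of the equation lives in degree 1, so it is determined on one pair and a last
    argument; there 3! and 4! cancel the 6 and 24, leaving the defect of the operator identity. *)
Lemma twisted_RB_MC : is_twisted_RB br rl rm rr Phi T <->
  (3`!%:R : K)^-1 *: l3 t t t + (4`!%:R : K)^-1 *: l4 t t t t = 0.
Proof.
pose F := (3`!%:R : K)^-1 *: l3 t t t + (4`!%:R : K)^-1 *: l4 t t t t.
have FE u v w : F [:: (u, v)] w = br (T u) (T v) (T w)
    - T (rl (T u) (T v) w + rm (T u) v (T w) + rr u (T v) (T w)
         + Phi (T u) (T v) (T w)).
  rewrite /F !fun2E l3_linear l4_linear scalerN !scalerA !mulVf ?charK //.
  by rewrite !scale1r [in RHS]linearD opprD addrA.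
have F0 s z : size s != 1%N -> F s z = 0.
  move=> sz; have hl (P : CV) : cochain 1 P -> P s z = 0.
    by case=> _; apply; rewrite eqz_nat.
  rewrite /F !fun2E (hl (l3 t t t)) ?(hl (l4 t t t t)) ?scaler0 ?addr0 //.
    by apply/cochain_Pr/hbr/hbr/hbr/hbr.
  by apply/cochain_Pr/hbr/hbr/hbr.
split=> [RB|F_eq0 u v w].
  apply/funext => s; apply/funext => z; rewrite -/F.
  case: s => [|[u v] [|X s]]; try exact: F0.
  by rewrite FE RB subrr.
by apply/eqP; rewrite -subr_eq0 -FE; apply/eqP; rewrite /F F_eq0.
Qed.

Lemma maurer_cartanE :
  is_maurer_cartan (@cochain K V g) (linf_op br rl rm rr Phi) t <->
  (3`!%:R : K)^-1 *: l3 t t t + (4`!%:R : K)^-1 *: l4 t t t t = 0.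
Proof.
have G0 k : k != 3 -> k != 4 -> linf_op br rl rm rr Phi (nseq k t) = 0.
  by move=> /negPf k3 /negPf k4; rewrite linf_op_size size_nseq k3 k4.
have := exp_series34 G0.
rewrite -[linf_op _ _ _ _ _ (nseq 3 t)]/(l3 t t t).
rewrite -[linf_op _ _ _ _ _ (nseq 4 t)]/(l4 t t t t) => <-.
by split=> [[]|]; [|split=> //; apply: cochain_linear].
Qed.

End MaurerCartan.

End Main.

Theorem theorem4p3 (K : closedFieldType) (charK0 : [pchar K] =i pred0)
    (g V : lmodType K) (br : g -> g -> g -> g)
    (rl : g -> g -> V -> V) (rm : g -> V -> g -> V) (rr : V -> g -> g -> V)
    (Phi : g -> g -> g -> V)
    (Hg : is_3Leibniz br) (HV : is_representation br rl rm rr)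
    (HPhi : is_2cocycle br rl rm rr Phi) :
  is_Linfty (@cochain K V g) (linf_op br rl rm rr Phi) /\
  forall T : {linear V -> g},
    let t := cochain_of_linear T in
    (is_twisted_RB br rl rm rr Phi T <->
     is_maurer_cartan (@cochain K V g) (linf_op br rl rm rr Phi) t) /\
    (is_maurer_cartan (@cochain K V g) (linf_op br rl rm rr Phi) t <->
     (3`!%:R : K)^-1 *: l3 br rl rm rr Phi t t t
     + (4`!%:R : K)^-1 *: l4 br rl rm rr Phi t t t t = 0).
Proof.
have charK n : (n%:R == 0 :> K) = (n == 0%N) by move/pcharf0P: charK0.
split; first exact: Linfty_cochain Hg HV HPhi charK.
move=> T t; have MC := maurer_cartanE br rl rm rr Phi T.
split=> //; apply: iff_trans (iff_sym MC).
exact: twisted_RB_MC Hg HV HPhi charK T.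
Qed.
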